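(* There is a constant $C_d>0$ depending only on $d$ such that the following holds. Let $\mathcal{M}=(\mathcal{T},\mathcal{E},\mathcal{P})$ be a mesh of $\Omega$ which is regular with parameters $\mu,\lambda\in(0,\frac12]$ and with mesh size $h<C_d\,\mu^{-1}$. Then $$\|u\|_{0,\infty}\le C\,|\ln(\mu h)|^{1-\frac1d}\,\|u\|_{1,d}$$ for all $u\in\mathbb{R}^{\mathcal{T}}$ and some constant $C>0$ depending only on $\Omega$, $\lambda$ and $\mu$.
   Context: Domain. Let $d\ge 2$ be an integer and let $\Omega\subset\mathbb{R}^d$ be a bounded, connected, open polyhedral set, i.e. an open set whose closure equals the closure of a finite union of polyhedra, a polyhedron being a bounded intersection of finitely many half-spaces (possibly non-convex); $\Omega$ is moreover a Lipschitz domain. $|\cdot|$ denotes the Euclidean norm of vectors, and for sets the $d$- or $(d-1)$-dimensional Hausdorff measure, as appropriate. $B(a,r)$ is the open ball of center $a$ and radius $r$ in $\mathbb{R}^d$, and $B_{d'}$ is the unit open ball of $\mathbb{R}^{d'}$. Mesh. A mesh $\mathcal{M}=(\mathcal{T},\mathcal{E},\mathcal{P})$ of $\Omega$ consists of a set $\mathcal{T}$ of open connected polyhedral subsets of $\Omega$ (cells), a set $\mathcal{E}$ of non-empty relatively open connected polyhedral subsets of hyperplanes of $\mathbb{R}^d$ (faces), and a family $\mathcal{P}=(x_K)_{K\in\mathcal{T}}$ of points of $\Omega$ (cell centers), such that: (i) $\overline\Omega=\bigcup_{K\in\mathcal{T}}\overline K$; (ii) for each $K\in\mathcal{T}$ there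 is $\mathcal{E}_K\subset\mathcal{E}$ with $\partial K=\bigcup_{\sigma\in\mathcal{E}_K}\overline\sigma$ and $|\sigma\cap\sigma'|=0$ for distinct $\sigma,\sigma'\in\mathcal{E}_K$, and $\mathcal{E}=\bigcup_K\mathcal{E}_K$; (iii) for $K\ne L$ in $\mathcal{T}$, either $|\overline K\cap\partial L|=|\partial K\cap\overline L|=0$, or $\mathcal{E}_{KL}:=\mathcal{E}_K\cap\mathcal{E}_L$ is non-empty and $\overline K\cap\overline L=\bigcup_{\sigma\in\mathcal{E}_{KL}}\overline\sigma$; the set of interior faces is $\mathcal{E}_{\rm int}=\{\sigma\in\mathcal{E}:\exists K\neq L,\ \sigma\in\mathcal{E}_{KL}\}$; (iv) with $\mathcal{E}_{\rm ext}=\{\sigma\in\mathcal{E}:\sigma\subset\partial\Omega\}$, for each $K$ either $|\overline K\cap\partial\Omega|=0$ or $\overline K\cap\partial\Omega=\bigcup_{\sigma\in\mathcal{E}_K\cap\mathcal{E}_{\rm ext}}\overline\sigma$; (v) $x_K\in K$ for all $K$. For $\sigma\in\mathcal{E}_{\rm int}$ the pair $\{K,L\}$ with $\sigma\in\mathcal{E}_{KL}$ is unique. The mesh size is $h=\max_{K\in\mathcal{T}}\operatorname{diam}(K)$. Regularity. The mesh is regular with parameters $\mu,\lambda\in(0,\frac12]$ if every $K\in\mathcal{T}$ is star-shaped with respect to the ball $B(x_K,\mu h)$, and $\lambda^{d-1}h^{d-1}|B_{d-1}|\le|\sigma|$ for every $\sigma\in\mathcal{E}$. Dual mesh. $P_{K\sigma}$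 is the open $d$-dimensional pyramid with base $\sigma\in\mathcal{E}_K$ and vertex $x_K$. For $\sigma\in\mathcal{E}_{\rm int}$, $\sigma\in\mathcal{E}_{KL}$, the diamond cell $D_\sigma$ is the interior of $\overline{P_{K\sigma}\cup P_{L\sigma}}$. Norms. For $u=(u_K)_{K\in\mathcal{T}}\in\mathbb{R}^{\mathcal{T}}$ let $u^{\mathcal{M}}=\sum_K u_K\mathbf{1}_K$, $\|u\|_{0,p}=\|u^{\mathcal{M}}\|_{L^p(\Omega)}$ for $1\le p\le\infty$, $$|u|_{1,d}=\Big(\sum_{\sigma\in\mathcal{E}_{\rm int},\,\sigma\in\mathcal{E}_{KL}}|\sigma|^d|D_\sigma|^{1-d}|u_L-u_K|^d\Big)^{1/d},\qquad \|u\|_{1,d}=\|u\|_{0,d}+|u|_{1,d}.$$ A constant depending only on listed data is independent of everything else, in particular of the mesh (including $h$) and of $u$. *)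

(* Defs.v *)
From HB Require Import structures.
From mathcomp Require Import all_boot all_order all_algebra.
From mathcomp Require Import all_classical all_reals all_analysis.

Set Implicit Arguments.
Unset Strict Implicit.
Unset Printing Implicit Defensive.

Import Order.TTheory GRing.Theory Num.Theory.
Import numFieldTopology.Exports numFieldNormedType.Exports.

Local Open Scope classical_set_scope.
Local Open Scope ring_scope.

(* The topology of ['rV[R]_n] is the product topology, but its library norm is
   the sup norm, hence the separate Euclidean norm. *)
Section euclidean.
Context {R : realType} {n : nat}.
Implicit Types (x y a : 'rV[R]_n) (A : set 'rV[R]_n).

Definition dotp x y : R := \sum_(i < n) x 0 i * y 0 i.

Definition enorm x : R := Num.sqrt (dotp x x).

Definition eball a (r : R) : set 'rV[R]_n := [set x | enorm (x - a) < r].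

(* The [0] makes the diameter of the empty set [0] instead of [-oo]. *)
Definition ediam A : \bar R :=
  ereal_sup [set r | r = 0%E \/
    exists x y, [/\ A x, A y & r = (enorm (x - y))%:E]].

Definition bdry A : set 'rV[R]_n := closure A `\` interior A.

Definition star_shaped_wrt A (B : set 'rV[R]_n) :=
  forall y z, B y -> A z ->
    forall t : R, 0 <= t <= 1 -> A ((1 - t) *: y + t *: z).

Definition polyhedron A := bounded_set A /\
  exists (k : nat) (a : 'I_k -> 'rV[R]_n) (b : 'I_k -> R),
    (forall i, a i != 0) /\ A = \bigcap_i [set x | dotp (a i) x <= b i].

(* Half-spaces are closed, so a polyhedron may be contained in a hyperplane;
   this makes the definition suitable both for open sets and for relatively
   open subsets of hyperplanes. *)
Definition polyhedral A :=
  exists (k : nat) (P : 'I_k -> set 'rV[R]_n),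
    (forall i, polyhedron (P i)) /\ closure A = closure (\bigcup_i P i).

Definition open_in_hyperplane A :=
  exists (a : 'rV[R]_n) (b : R), a != 0 /\
    exists2 U : set 'rV[R]_n, open U & A = U `&` [set x | dotp a x = b].

(* Near each boundary point, [A] is the strict epigraph, in the direction of a
   unit vector [e], of a Lipschitz function [phi] on the hyperplane orthogonal
   to [e]; [phi] is only evaluated on that hyperplane. *)
Definition lipschitz_boundary A :=
  forall x0, bdry A x0 ->
    exists (r L : R) (e : 'rV[R]_n) (phi : 'rV[R]_n -> R),
    [/\ 0 < r, enorm e = 1,
        (forall x y, dotp x e = 0 -> dotp y e = 0 ->
           `|phi x - phi y| <= L * enorm (x - y)) &
        A `&` eball x0 r =
        [set x | phi (x - dotp x e *: e) < dotp x e] `&` eball x0 r].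

End euclidean.

(* Volume of the unit ball of [R^s], from the recursion
   omega_{s+2} = 2 pi / (s+2) omega_s. *)
Fixpoint unit_ball_volume (R : realType) (s : nat) : R :=
  match s with
  | 0 => 1
  | 1 => 2
  | s'.+2 => 2 * pi / s'.+2%:R * unit_ball_volume R s'
  end.

Section hausdorff.
Context {R : realType} {n : nat}.
Variable s : nat.
Implicit Types (A U : set 'rV[R]_n).
Local Open Scope ereal_scope.

(* The case distinction only matters for [s = 0], as [0 ^+ 0 = 1]. *)
Definition hausdorff_weight U : \bar R :=
  if U == set0 then 0
  else (unit_ball_volume R s)%:E * (ediam U * (2^-1)%:E) ^+ s.

Definition hausdorff_cover (delta : R) A : set ((set 'rV[R]_n)^nat) :=
  [set U | (forall k, ediam (U k) <= delta%:E) /\ A `<=` \bigcup_k U k].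

Definition hausdorff_pre (delta : R) A : \bar R :=
  ereal_inf [set \sum_(k <oo) hausdorff_weight (U k) |
             U in hausdorff_cover delta A].

(* The [s]-dimensional Hausdorff outer measure, normalized so as to coincide
   with the Lebesgue outer measure for [s = n]. *)
Definition hausdorff A : \bar R :=
  ereal_sup [set hausdorff_pre delta A | delta in [set r : R | (0 < r)%R]].

End hausdorff.
Arguments hausdorff {R n} s A.

Section hausdorff_outer_measure.
Context (R : realType) (n s : nat).
Implicit Types (A U : set 'rV[R]_n).
Local Open Scope ereal_scope.
Local Notation w := (@hausdorff_weight R n s).
Local Notation Hd := (@hausdorff_pre R n s).

Lemma unit_ball_volume_gt0 k : (0 < unit_ball_volume R k)%R.
Proof.
suff [] : (0 < unit_ball_volume R k)%R /\ (0 < unit_ball_volume R k.+1)%R by [].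
elim: k => [|k [h1 h2]]; split => //.
by rewrite mulr_gt0// divr_gt0// mulr_gt0// pi_gt0.
Qed.

Lemma ediam_ge0 A : 0 <= ediam A.
Proof. by apply: ereal_sup_ubound; left. Qed.

Lemma ediam0 : ediam (set0 : set 'rV[R]_n) = 0.
Proof.
apply/eqP; rewrite eq_le ediam_ge0 andbT.
by apply: ge_ereal_sup => r /= [->//|[x [y []]]].
Qed.

Lemma hausdorff_weight_ge0 U : 0 <= w U.
Proof.
rewrite /hausdorff_weight; case: ifP => // _.
apply: mule_ge0; first by rewrite lee_fin ltW// unit_ball_volume_gt0.
by apply: expe_ge0; apply: mule_ge0 => //; exact: ediam_ge0.
Qed.

Lemma hausdorff_weight0 : w set0 = 0.
Proof. by rewrite /hausdorff_weight eqxx. Qed.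

Lemma hausdorff_pre_ge0 delta A : 0 <= Hd delta A.
Proof.
apply: le_ereal_inf_tmp => x [B _ <-].
by apply: nneseries_ge0 => k _ _; exact: hausdorff_weight_ge0.
Qed.

Lemma le_hausdorff_pre delta : {homo Hd delta : A B / A `<=` B >-> A <= B}.
Proof.
move=> A B AB; apply/ereal_inf_le_tmp => x [U [dU BU]] <-.
by exists U => //; split => //; exact: subset_trans BU.
Qed.

Lemma hausdorff_pre_sigma_subadditive delta : sigma_subadditive (Hd delta).
Proof.
move=> A; have [[i ioo]|] := pselect (exists i, Hd delta (A i) = +oo).
  rewrite (eseries_pinfty _ _ ioo) ?leey// => k _.
  by rewrite -ltNye (lt_le_trans _ (hausdorff_pre_ge0 _ _)).
rewrite -forallNE => Aoo.
suff add2e (e : {posnum R}) :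
    Hd delta (\bigcup_k A k) <= \sum_(i <oo) Hd delta (A i) + e%:num%:E.
  by apply/lee_addgt0Pr => _/posnumP[].
rewrite (le_trans _ (epsilon_trick _ _ _))//; last first.
  by move=> k; exact: hausdorff_pre_ge0.
pose P k (B : (set 'rV[R]_n)^nat) := hausdorff_cover delta (A k) B /\
  \sum_(j <oo) w (B j) <= Hd delta (A k) + (e%:num / (2 ^ k.+1)%:R)%:E.
have [G PG] : {G : ((set 'rV[R]_n)^nat)^nat & forall k, P k (G k)}.
  apply: (@choice _ _ P) => k; rewrite /P.
  have en1 : (0 < e%:num / (2 ^ k.+1)%:R)%R by [].
  have fin : Hd delta (A k) \is a fin_num.
    by rewrite ge0_fin_numE ?hausdorff_pre_ge0// ltey; apply/eqP.
  have [x [B cB <-] /ltW xS] := lb_ereal_inf_adherent en1 fin.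
  by exists B.
have wG_ge0 x : 0 <= (w \o uncurry G) x by exact: hausdorff_weight_ge0.
apply: (@le_trans _ _ (\esum_(i in setT) (w \o uncurry G) i)).
  apply: ereal_inf_lbound => /=.
  have /card_esym/ppcard_eqP[f] := card_nat2.
  exists (uncurry G \o f).
    split => [i /=|]; first by case: (f i) => a b; exact: (PG a).1.1.
    apply: (@subset_trans _  (\bigcup_k \bigcup_j G k j)) => [t [i _]|].
      by move=> /(PG i).1.2 -[j _ ?]; exists i => //; exists j.
    move=> t [i _ [j _ Bijt]]; exists (f^-1%FUN (i, j)) => //=.
    by rewrite invK ?inE.
  rewrite -(esum_pred_image (w \o uncurry G) _ xpredT) ?[fun=> _]set_true//.
  by rewrite image_eq.
rewrite (_ : esum _ _ = \sum_(i <oo) \sum_(j <oo ) w (G i j)); last first.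
  pose J : nat -> set (nat * nat) := fun i => [set (i, j) | j in setT].
  rewrite (_ : setT = \bigcup_k J k); last first.
    by rewrite predeqE => -[a b]; split => // _; exists a => //; exists b.
  rewrite esum_bigcupT /=; last 2 first.
    - apply/trivIsetP => i j _ _ ij.
      rewrite predeqE => -[k m] /=; split => //= -[] [_] _ [<-{k} _].
      by move=> [m' _] [] /esym/eqP; rewrite (negbTE ij).
    - by move=> /= [k m]; exact: hausdorff_weight_ge0.
  rewrite -(image_id [set: nat]) -fun_true esum_pred_image//; last first.
    by move=> k _; apply: esum_ge0 => i _; exact: hausdorff_weight_ge0.
  apply: eq_eseriesr => /= j _.
  rewrite -(esum_pred_image (w \o uncurry G) (pair j) predT)//=; last 2 first.
  - by move=> k _; exact: hausdorff_weight_ge0.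
  - by move=> ? ? _ _; exact: (@can_inj _ _ _ snd).
  by congr esum; rewrite predeqE => -[a b]; split; move=> [i _ <-]; exists i.
apply: lee_nneseries => [i _ _|i _]; last exact: (PG i).2.
by apply: nneseries_ge0 => m *; exact: (wG_ge0 (i, m)).
Qed.

Lemma hausdorff0 : hausdorff s (set0 : set 'rV[R]_n) = 0.
Proof.
apply/eqP; rewrite eq_le; apply/andP; split.
  apply: ge_ereal_sup => _ [delta /= d0 <-]; apply: ereal_inf_lbound.
  exists (fun=> set0); first by split => // k; rewrite ediam0 lee_fin ltW.
  by apply: eseries0 => k _ _; exact: hausdorff_weight0.
apply: le_ereal_sup_tmp; exists (Hd 1 set0); last exact: hausdorff_pre_ge0.
by exists 1%R => //=.
Qed.

Lemma hausdorff_ge0 A : 0 <= hausdorff s A.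
Proof.
apply: le_ereal_sup_tmp; exists (Hd 1 A); last exact: hausdorff_pre_ge0.
by exists 1%R => //=.
Qed.

Lemma le_hausdorff :
  {homo (@hausdorff R n s) : A B / A `<=` B >-> A <= B}.
Proof.
move=> A B AB; apply: ge_ereal_sup => _ [delta d0 <-].
apply: le_ereal_sup_tmp; exists (Hd delta B); first by exists delta.
exact: le_hausdorff_pre.
Qed.

Lemma hausdorff_sigma_subadditive : sigma_subadditive (@hausdorff R n s).
Proof.
move=> A; apply: ge_ereal_sup => _ [delta d0 <-].
apply: le_trans (hausdorff_pre_sigma_subadditive _ _) _.
apply: lee_nneseries => [i _ _|i _]; first exact: hausdorff_pre_ge0.
by apply: ereal_sup_ubound; exists delta.
Qed.

HB.instance Definition _ := isOuterMeasure.Build R 'rV[R]_n (@hausdorff R n s)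
  hausdorff0 hausdorff_ge0 le_hausdorff hausdorff_sigma_subadditive.

End hausdorff_outer_measure.

(* Lebesgue measure on [R^d], on the Lebesgue-measurable sets, obtained as the
   restriction of the [d]-dimensional Hausdorff outer measure to its
   Caratheodory-measurable sets. *)
Definition lebesgue_outer (R : realType) (d : nat) :
  {outer_measure set 'rV[R]_d -> \bar R} := @hausdorff R d d.

Definition lebesgue_Rd (R : realType) (d : nat) :
    {measure set (caratheodory_type (lebesgue_outer R d)) -> \bar R} :=
  (lebesgue_outer R d :
     set (caratheodory_type (lebesgue_outer R d)) -> \bar R).

(* A cell or a face is represented by an index in a finite type; [faces_of K]
   stands for E_K. All vanishing conditions below concern subsets of faces or of
   boundaries, hence the [d - 1]-dimensional measure. *)
Record mesh (R : realType) (d : nat) (Omega : set 'rV[R]_d) (T E : finType) :=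
Mesh {
  cell : T -> set 'rV[R]_d ;
  face : E -> set 'rV[R]_d ;
  center : T -> 'rV[R]_d ;
  faces_of : T -> {set E} ;
  cell_inj : injective cell ;
  face_inj : injective face ;
  cell_open : forall K, open (cell K) ;
  cell_connected : forall K, connected (cell K) ;
  cell_polyhedral : forall K, polyhedral (cell K) ;
  cell_sub : forall K, cell K `<=` Omega ;
  face_nonempty : forall e, face e !=set0 ;
  face_open : forall e, open_in_hyperplane (face e) ;
  face_connected : forall e, connected (face e) ;
  face_polyhedral : forall e, polyhedral (face e) ;
  cells_cover : closure Omega = \bigcup_K closure (cell K) ;
  bdry_cell : forall K,
    bdry (cell K) = \bigcup_(e in [set` faces_of K]) closure (face e) ;
  faces_disjoint : forall K e e', e \in faces_of K -> e' \in faces_of K ->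
    e != e' -> hausdorff d.-1 (face e `&` face e') = 0%E ;
  faces_cover : forall e, exists K, e \in faces_of K ;
  cells_meet : forall K L, K != L ->
    (hausdorff d.-1 (closure (cell K) `&` bdry (cell L)) = 0%E /\
     hausdorff d.-1 (bdry (cell K) `&` closure (cell L)) = 0%E) \/
    ((exists e, e \in faces_of K /\ e \in faces_of L) /\
     closure (cell K) `&` closure (cell L) =
       \bigcup_(e in [set e | e \in faces_of K /\ e \in faces_of L])
         closure (face e)) ;
  cell_meets_bdry : forall K,
    hausdorff d.-1 (closure (cell K) `&` bdry Omega) = 0%E \/
    closure (cell K) `&` bdry Omega =
      \bigcup_(e in [set e | e \in faces_of K /\ face e `<=` bdry Omega])
        closure (face e) ;
  center_in : forall K, cell K (center K)
}.

Section mesh_quantities.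
Context {R : realType} {d : nat} {Omega : set 'rV[R]_d} {T E : finType}.
Variable M : mesh Omega T E.
Implicit Types (K L : T) (e : E) (u : T -> R).

(* Cells are bounded when [Omega] is, so that [fine] loses no information. *)
Definition mesh_size : R := \big[Num.max/0]_(K : T) fine (ediam (cell M K)).

Definition regular_mesh (mu lambda : R) :=
  (forall K, star_shaped_wrt (cell M K)
     (eball (center M K) (mu * mesh_size))) /\
  (forall e, ((lambda ^+ d.-1 * mesh_size ^+ d.-1)%:E *
     hausdorff d.-1 (eball (0 : 'rV[R]_d.-1) 1) <=
     hausdorff d.-1 (face M e))%E).

Definition pyramid K e : set 'rV[R]_d :=
  [set x | exists t y, [/\ 0 < t < 1, face M e y &
                           x = (1 - t) *: center M K + t *: y]].

Definition diamond K L e : set 'rV[R]_d :=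
  interior (closure (pyramid K e `|` pyramid L e)).

Definition face_area e : R := fine (hausdorff d.-1 (face M e)).

Definition diamond_volume K L e : R := fine (hausdorff d (diamond K L e)).

Definition cellwise u : 'rV[R]_d -> R :=
  fun x => \sum_(K : T) u K * \1_(cell M K) x.

Definition norm0 (p : \bar R) u : \bar R :=
  'N[lebesgue_Rd R d]_p[EFin \o (cellwise u \_ Omega)].

(* The sum runs over the ordered pairs [(K, L)] sharing the face [e], i.e.
   twice over each interior face, whence the factor 1/2. *)
Definition seminorm1d u : R :=
  (2^-1 * \sum_(K : T) \sum_(L : T | L != K)
     \sum_(e | (e \in faces_of M K) && (e \in faces_of M L))
       face_area e ^+ d * diamond_volume K L e ^- d.-1 *
       `|u L - u K| ^+ d) `^ d%:R^-1.

Definition norm1d u : \bar R := (norm0 d%:R%:E u + (seminorm1d u)%:E)%E.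

End mesh_quantities.

(* Main.v *)
Require Import Defs.
From mathcomp Require Import all_boot all_order all_algebra finmap.
From mathcomp Require Import all_classical all_reals all_analysis.
From mathcomp Require Import ring lra measurable_realfun.

Set Implicit Arguments.
Unset Strict Implicit.
Unset Printing Implicit Defensive.

Import Order.TTheory GRing.Theory Num.Theory.
Import numFieldTopology.Exports numFieldNormedType.Exports.

Local Open Scope classical_set_scope.
Local Open Scope ring_scope.

(** Let [n.+1] be the dimension, [h] the mesh size, and write [K ~ L] when the
    cells [K] and [L] share a face. Up to constants the statement is a
    combinatorial one: the weight of a face in the seminorm is bounded from
    below, because [(h ^ n) ^ n.+1 / (h ^ n.+1) ^ n = 1] ([seminorm1d_ge]), and
    a cell has volume at least [c h ^ n.+1] ([norm0_d_ge], [cell_volume_ge]).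
    It remains to bound [`|u K0|] by
    [h (\sum_K `|u K| ^ n.+1) ^ (1 / n.+1)] plus the product of
    [`|ln (mu h)| ^ (n / n.+1)] and of the [n.+1]-norm of the differences
    [u L - u K], [K ~ L] ([value_le]).

    This is the discrete form of the argument that bounds a function at the
    vertex of a cone by a mean value and by the Riesz potential of its gradient.
    A bounded Lipschitz domain contains at each of its points a cone of fixed
    size ([cone_condition]). From the center of [K0], follow rays of this cone
    in [N ^ n.+1] directions with steps of length of order [h], where [N] is of
    order [1 / h]. The points reached after [N] steps form a grid of spacing of
    order [h] in a set of fixed size, so that the mean of [u] over them is
    controlled by its Lebesgue norm. Each step changes [u] at most by the sum of the
    differences over the boundedly many pairs [K ~ L] near the step ([jump]).
    After averaging over the directions, a pair at distance [t h] of the vertex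
    has weight at most of order [t ^ - n], and Hoelder's inequality costs
    [(\sum_(t < N) 1 / t) ^ (n / n.+1)], which is the power of the logarithm
    ([sum_near_le], [value_le_paths]).

    That a step is controlled by pairs sharing a face is where the axioms of a
    mesh enter. If the cells touching a small ball split into two families
    without common face, the closures of the families meet in a null set for the
    [n]-dimensional Hausdorff measure; such a set does not separate a ball,
    since its projection along a suitable direction would contain a cube
    ([hausdorff_separator_gt0], [cells_chain]). The measure theory used is
    elementary: a Lipschitz image of a set containing a cube forces a lower
    bound on its Hausdorff measure ([hausdorff_ge_cube]), covering by a grid
    gives upper bounds ([hausdorff_le_image]), and open sets are measurable
    ([open_caratheodory]). *)

(** * Norms, counting, and Hausdorff measure of cubes *)

Section norms.
Context {R : realType} {n : nat}.
Implicit Types x y : 'rV[R]_n.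

Lemma coord_le_norm x i : `|x 0 i| <= `|x|.
Proof.
rewrite (_ : `|x| = mx_norm x)// mx_normrE; apply/bigmax_geP; right => /=.
by exists (0, i).
Qed.

Lemma norm_le_coord x r : 0 <= r -> (forall i, `|x 0 i| <= r) -> `|x| <= r.
Proof.
move=> r0 H; rewrite (_ : `|x| = mx_norm x)// mx_normrE; apply/bigmax_leP; split => //.
by move=> [i j] _ /=; rewrite (ord1 i).
Qed.

Lemma dotp_ge0 x : 0 <= dotp x x.
Proof. by apply: sumr_ge0 => i _; rewrite -expr2 sqr_ge0. Qed.

Lemma norm_le_enorm x : `|x| <= enorm x.
Proof.
apply: norm_le_coord => [|i]; first exact: sqrtr_ge0.
rewrite -sqrtr_sqr ler_sqrt ?dotp_ge0//.
rewrite /dotp (bigD1 i)//= expr2 lerDl.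
by apply: sumr_ge0 => j _; rewrite -expr2 sqr_ge0.
Qed.

Lemma enorm_le_norm x : enorm x <= n%:R * `|x|.
Proof.
have h0 : 0 <= n%:R * `|x| by rewrite mulr_ge0.
rewrite -(ger0_norm h0) -sqrtr_sqr ler_sqrt ?sqr_ge0//.
apply: (@le_trans _ _ (\sum_(i < n) `|x| ^+ 2)).
  apply: ler_sum => i _; rewrite -expr2 -real_normK ?num_real//.
  by rewrite lerXn2r ?nnegrE// coord_le_norm.
rewrite sumr_const card_ord exprMn -[leLHS]mulr_natl.
rewrite ler_pM ?sqr_ge0 ?ler0n//.
by rewrite -natrX ler_nat; case: (n) => // m; rewrite leq_pmulr.
Qed.

End norms.

Section counting.
Context {R : realType}.

Lemma card_ord_interval n (a b r : R) : 0 < a -> 0 <= r ->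
  #|[set k : 'I_n | `|a * k%:R - b| <= r]%SET|%:R <= 2 * r / a + 1.
Proof.
move=> a0 r0; set S := [set k | _]%SET.
have q0 : 0 <= 2 * r / a by rewrite divr_ge0 ?mulr_ge0// ltW.
have [->|[i0 i0S]] := set_0Vmem S; first by rewrite cards0 addr_ge0.
case: (arg_minnP (fun i : 'I_n => val i) i0S) => j jS jmin.
pose N := Num.truncn (2 * r / a).
have NP : N%:R <= 2 * r / a < N.+1%:R by exact: truncn_itv.
have inS k : k \in S -> `|a * k%:R - b| <= r by rewrite inE.
have bnd k : k \in S -> (k - j < N.+1)%N.
  move=> kS; have jk := jmin _ kS.
  have := inS k kS; have := inS j jS.
  rewrite !ler_norml => /andP[h1 h2] /andP[h3 h4].
  rewrite -(ltr_nat R) (le_lt_trans _ (andP NP).2)// natrB//.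
  by rewrite ler_pdivlMr//; lra.
have inj : {in S &, injective (fun k : 'I_n => inord (k - j) : 'I_N.+1)}.
  move=> k l kS lS /(congr1 (@nat_of_ord _)); rewrite /= !inordK ?bnd// => e.
  by apply: val_inj; rewrite /= -(subnK (jmin _ kS)) -(subnK (jmin _ lS)) e.
rewrite -(card_in_imset inj).
apply: (@le_trans _ _ N.+1%:R); last first.
  by rewrite -natr1 lerD2r; case/andP: NP.
by rewrite ler_nat (leq_trans (max_card _))// card_ord.
Qed.

Lemma card_ffun_box d n (a r : R) (b : 'I_d -> R) : 0 < a -> 0 <= r ->
  #|[set k : {ffun 'I_d -> 'I_n} | [forall i, `|a * (k i)%:R - b i| <= r]]%SET|%:R
    <= (2 * r / a + 1) ^+ d.
Proof.
move=> a0 r0.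
pose F i := [set k : 'I_n | `|a * k%:R - b i| <= r]%SET.
have -> : #|[set k : {ffun 'I_d -> 'I_n} |
    [forall i, `|a * (k i)%:R - b i| <= r]]%SET| = #|family (fun i => mem (F i))|.
  apply: eq_card => k; rewrite inE; apply/forallP/familyP => h i;
    by have := h i; rewrite inE.
rewrite card_family foldrE big_map big_enum /= natr_prod.
rewrite -[X in _ ^+ X]card_ord -prodr_const.
by apply: ler_prod => i _; rewrite ler0n card_ord_interval.
Qed.

(** Rounding the coordinates to multiples of [s] is injective on points at
    mutual distance at least [s]. *)
Lemma card_separated d (T : finType) (S : {set T}) (pos : T -> 'rV[R]_d)
    (p : 'rV[R]_d) (s r : R) : 0 < s -> 0 <= r ->
  {in S &, forall K L, K != L -> s <= `|pos K - pos L|} ->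
  {in S, forall K, `|pos K - p| <= r} ->
  #|S|%:R <= (2 * r / s + 1) ^+ d.
Proof.
move=> s0 r0 sep near.
pose N := Num.truncn (2 * r / s).
have q0 : 0 <= 2 * r / s by rewrite divr_ge0 ?mulr_ge0// ltW.
have NP : N%:R <= 2 * r / s < N.+1%:R by exact: truncn_itv.
pose y K i := (pos K 0 i - p 0 i + r) / s.
have y0 K i : K \in S -> 0 <= y K i <= 2 * r / s.
  move=> /near nK; have := le_trans (coord_le_norm _ i) nK.
  rewrite !mxE ler_norml => /andP[h1 h2].
  by rewrite ler_pM2r ?invr_gt0// divr_ge0 ?(ltW s0)//=; lra.
pose f K : {ffun 'I_d -> 'I_N.+1} := [ffun i => inord (Num.truncn (y K i))].
have lt K i : K \in S -> (Num.truncn (y K i) < N.+1)%N.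
  move=> KS; have /andP[h1 h2] := y0 K i KS.
  have /andP[h3 _] := truncn_itv h1.
  by rewrite -(ltr_nat R) (le_lt_trans h3)// (le_lt_trans h2)//; case/andP: NP.
have inj : {in S &, injective f}.
  move=> K L KS LS e; apply/eqP/negPn/negP => KL.
  have := sep _ _ KS LS KL; apply/negP; rewrite -ltNge.
  pose c : R := \big[Num.max/0]_i `|(pos K - pos L) 0 i|.
  have cs : c < s.
    apply/bigmax_ltP; split => // i _.
    have := congr1 (fun g : {ffun _ -> _} => nat_of_ord (g i)) e.
    rewrite !ffunE /= !inordK ?lt// => e'.
    have /andP[h1 _] := y0 K i KS; have /andP[h2 _] := y0 L i LS.
    have /andP[] := truncn_itv h1; have /andP[] := truncn_itv h2.
    rewrite e' -!natr1 /y !ler_pdivlMr// !ltr_pdivrMr// !mxE ltr_norml.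
    by move=> *; apply/andP; split; lra.
  apply: le_lt_trans cs; apply: norm_le_coord; first exact: bigmax_ge_id.
  by move=> i; exact: (le_bigmax _ (fun i => `|(pos K - pos L) 0 i|)).
rewrite -(card_in_imset inj).
apply: (@le_trans _ _ (N.+1%:R ^+ d)); last first.
  by rewrite lerXn2r ?nnegrE ?addr_ge0// -natr1 lerD2r; case/andP: NP.
rewrite -natrX ler_nat (leq_trans (max_card _))//.
by rewrite card_ffun !card_ord.
Qed.

End counting.

Lemma card_le_sum_cover (T : finType) K (A : 'I_K -> {set T}) :
  (forall x, exists k, x \in A k) -> (#|T| <= \sum_k #|A k|)%N.
Proof.
move=> H; have -> : #|T| = #|(\bigcup_k A k)%SET|.
  rewrite -cardsT; apply: eq_card => x; rewrite inE.
  by have [k xk] := H x; apply/esym/finset.bigcupP; exists k.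
elim/big_rec2 : _ => [|i y B _ h]; first by rewrite cards0.
by rewrite (leq_trans (leq_card_setU _ _))// leq_add2l.
Qed.

Section hausdorff_bounds.
Context {R : realType}.

Definition cube {n} (c : 'rV[R]_n) (r : R) : set 'rV[R]_n :=
  [set x | forall i, c 0 i <= x 0 i <= c 0 i + r].

Lemma cube_compact n (c : 'rV[R]_n) r : compact (cube c r).
Proof.
have := @rV_compact _ n (fun i => `[c 0 i, c 0 i + r]%classic)
  (fun i => @segment_compact _ _ _).
congr compact; apply/seteqP; split => x /= h i; have := h i;
  by rewrite ?in_itv.
Qed.

(** The lower bound for the measure of a cube. By compactness finitely many of
    the sets, slightly enlarged to be open, cover the cube; counting the points
    of a fine grid in each of them compares their diameters with [r]. *)
Lemma cube_cover_sum s (c : 'rV[R]_s) (r e : R) (V : (set 'rV[R]_s)^nat)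
    (l : nat -> R) :
  0 < r -> 0 < e <= 1 -> (0 < s)%N -> (forall k, 0 <= l k) ->
  (forall k x y, V k x -> V k y -> `|x - y| <= l k) ->
  cube c r `<=` \bigcup_k V k ->
  exists K, r ^+ s <= 6 ^+ s * (\sum_(k < K) l k ^+ s + e).
Proof.
move=> r0 /andP[e0 e1] s0 l0 Vl cV.
(* the enlargements are summable with sum at most [e] *)
pose eta k : R := e / (2 ^ k.+1)%:R.
have eta0 k : 0 < eta k by rewrite divr_gt0// ltr0n expn_gt0.
have eta1 k : eta k <= 1.
  rewrite ler_pdivrMr ?ltr0n ?expn_gt0// mul1r (le_trans e1)//.
  by rewrite ler1n expn_gt0.
pose W k := \bigcup_(x in V k) ball x (eta k / 2).
have Wo k : open (W k).
  by apply: bigcup_open => x _; apply: ball_open; rewrite divr_gt0.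
pose m k := l k + eta k.
have m0 k : 0 < m k by rewrite ltr_wpDl.
have Wm k x y : W k x -> W k y -> `|x - y| <= m k.
  move=> [a Va xa] [b Vb yb]; rewrite (_ : x - y = (x - a) + (a - b) + (b - y));
    last by rewrite -!addrA addKr addKr.
  rewrite (le_trans (ler_normD _ _))// (@le_trans _ _ (eta k / 2 + l k + eta k / 2))//.
    rewrite lerD//.
      rewrite (le_trans (ler_normD _ _))// lerD ?Vl//.
      by move: xa; rewrite -ball_normE /= distrC => /ltW.
    by move: yb; rewrite -ball_normE /= => /ltW.
  by rewrite /m; lra.
have cW : cube c r `<=` cover [set: nat] W.
  move=> x /cV[k _ Vx]; exists k => //; exists x => //.
  by apply: ballxx; rewrite divr_gt0.
have := @cube_compact s c r; rewrite compact_cover => /(_ _ _ _ (fun k _ => Wo k) cW).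
move=> [D _ DW].
pose K := (\max_(k <- enum_fset D) k).+1; exists K.
have DK k : k \in D -> (k < K)%N.
  by move=> kD; rewrite ltnS; exact: (@leq_bigmax_seq _ (enum_fset D) xpredT id).
(* a spacing [r / N] smaller than each [m k] absorbs the rounding in the counts *)
have [N N0 NP] : exists2 N, (0 < N)%N & forall k : 'I_K, 1 <= m k * N%:R / r.
  exists (\max_(k < K) Num.truncn (r / m k)).+1 => // k.
  have q0 : 0 <= r / m k by rewrite divr_ge0 ?ltW.
  rewrite ler_pdivlMr// mul1r mulrC -ler_pdivrMr//.
  have /andP[_ /ltW h] := truncn_itv q0; rewrite (le_trans h)// ler_nat ltnS.
  exact: (@leq_bigmax _ (fun k : 'I_K => Num.truncn (r / m k))).
pose g (j : {ffun 'I_s -> 'I_N}) : 'rV[R]_s :=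
  \row_i (c 0 i + r / N%:R * (j i)%:R).
have NR : (0 : R) < N%:R by rewrite ltr0n.
have gc j : cube c r (g j).
  move=> i; have j0 : 0 <= r / N%:R * (j i)%:R by rewrite mulr_ge0 ?divr_ge0 ?(ltW r0).
  rewrite mxE lerDl j0 lerD2l -mulrA ler_piMr ?(ltW r0)//.
  by rewrite mulrC ler_pdivrMr// mul1r ltW// ltr_nat.
pose A (k : 'I_K) := [set j | `[< W k (g j) >]]%SET.
have cA j : exists k, j \in A k.
  have [k kD Wk] := DW _ (gc j); exists (Ordinal (DK k kD)).
  by rewrite inE; apply/asboolP.
have Ak k : #|A k|%:R <= (3 * m k * N%:R / r) ^+ s.
  have [->|[j0]] := set_0Vmem (A k).
    by rewrite cards0 exprn_ge0// !mulr_ge0 ?invr_ge0 ?ltW.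
  rewrite inE => /asboolP Wj0.
  have rN : 0 < r / N%:R by rewrite divr_gt0.
  have := @card_ffun_box R s N _ (m k) (fun i => g j0 0 i - c 0 i) rN (ltW (m0 k)).
  move=> cardb; apply: (@le_trans _ _ ((2 * m k / (r / N%:R) + 1) ^+ s)); last first.
    rewrite lerXn2r ?nnegrE ?addr_ge0 ?divr_ge0 ?mulr_ge0 ?invr_ge0 ?(ltW (m0 _)) ?(ltW r0)//.
    have := NP k; rewrite invf_div; set q := m k * N%:R / r => q1.
    rewrite [leLHS](_ : _ = 2 * q + 1); last by rewrite /q; ring.
    rewrite [leRHS](_ : _ = 3 * q); last by rewrite /q; ring.
    lra.
  apply: le_trans cardb.
  rewrite ler_nat subset_leq_card//; apply/fintype.subsetP => j.
  move=> jA; have Wj : W k (g j) by apply/asboolP; move: jA; rewrite inE.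
  rewrite inE; apply/forallP => i.
  have := le_trans (coord_le_norm _ i) (Wm _ _ _ Wj Wj0).
  by rewrite !mxE; congr (`|_| <= _); ring.
have : (N ^ s)%:R <= \sum_(k < K) (3 * m k * N%:R / r) ^+ s :> R.
  apply: (@le_trans _ _ (\sum_(k < K) #|A k|%:R)); last exact: ler_sum.
  rewrite -natr_sum ler_nat; have := card_le_sum_cover cA.
  by rewrite card_ffun !card_ord.
have -> : \sum_(k < K) (3 * m k * N%:R / r) ^+ s =
   (N%:R / r) ^+ s * \sum_(k < K) (3 * m k) ^+ s.
  by rewrite big_distrr /=; apply: eq_bigr => k _; rewrite -exprMn; congr (_ ^+ _); ring.
rewrite natrX expr_div_n mulrAC ler_pdivlMr ?exprn_gt0//.
rewrite ler_pM2l ?exprn_gt0// => /le_trans; apply.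
have etas : \sum_(k < K) eta k <= e.
  suff : \sum_(k < K) eta k = e * (1 - 1 / (2 ^ K)%:R).
    move=> ->; rewrite ler_piMr ?ltW// gerBl divr_ge0//.
  elim: {Ak A cA DK NP} K => [|K' IH]; first by rewrite big_ord0 expn0 divr1 subrr mulr0.
  rewrite big_ord_recr /= IH /eta expnS natrM.
  have : (2 ^ K')%:R != 0 :> R by rewrite pnatr_eq0 -lt0n expn_gt0.
  by move=> h; field.
apply: (@le_trans _ _ (6 ^+ s * \sum_(k < K) (l k ^+ s + eta k))); last first.
  by rewrite ler_pM2l ?exprn_gt0// big_split /= lerD2l.
rewrite big_distrr /=; apply: ler_sum => k _.
rewrite (_ : 6 = 3 * 2 :> R); last by ring.
rewrite !exprMn -mulrA ler_pM2l ?exprn_gt0//.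
have etak : eta k ^+ s <= eta k.
  by rewrite -[leRHS]expr1 ler_wiXn2l// ltW.
have [h|h] := leP (l k) (eta k).
  apply: (@le_trans _ _ ((2 * eta k) ^+ s)).
    rewrite lerXn2r ?nnegrE ?(ltW (m0 _)) ?mulr_ge0 ?(ltW (eta0 _))// /m; lra.
  rewrite exprMn ler_pM2l ?exprn_gt0// (le_trans etak)// lerDr.
  by rewrite exprn_ge0.
apply: (@le_trans _ _ ((2 * l k) ^+ s)).
  by rewrite lerXn2r ?nnegrE ?(ltW (m0 _)) ?mulr_ge0// /m; lra.
by rewrite exprMn ler_pM2l ?exprn_gt0// lerDl ltW.
Qed.

Lemma enorm_le_ediam n (U : set 'rV[R]_n) x y : U x -> U y ->
  ((enorm (x - y))%:E <= ediam U)%E.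
Proof. by move=> Ux Uy; apply: ereal_sup_ubound; right; exists x, y. Qed.

Lemma hausdorff_weightE n s (U : set 'rV[R]_n) : (0 < s)%N ->
  ediam U \is a fin_num ->
  hausdorff_weight s U = (unit_ball_volume R s * (fine (ediam U) / 2) ^+ s)%:E.
Proof.
move=> s0 Uf; rewrite /hausdorff_weight; case: eqP => [->|_].
  by rewrite ediam0 /= mul0r expr0n gtn_eqF// mulr0.
by rewrite -{1}(fineK Uf) -EFinM -EFin_expe -EFinM.
Qed.

(** The image by [f] of a cover of [A] covers the cube, with diameters
    multiplied by at most [L]. *)
Lemma hausdorff_ge_cube n s (A : set 'rV[R]_n) (f : 'rV[R]_n -> 'rV[R]_s)
    (L r : R) (c : 'rV[R]_s) :
  (0 < s)%N -> 0 < L -> 0 < r ->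
  (forall x y, A x -> A y -> `|f x - f y| <= L * `|x - y|) ->
  cube c r `<=` f @` A ->
  ((unit_ball_volume R s * (r / (12 * L)) ^+ s)%:E <= hausdorff s A)%E.
Proof.
move=> s0 L0 r0 fL cA; set w := unit_ball_volume R s.
have w0 : 0 < w by exact: unit_ball_volume_gt0.
apply: (@le_trans _ _ (hausdorff_pre s 1 A)); last first.
  by apply: ereal_sup_ubound; exists 1 => //=.
apply: le_ereal_inf_tmp => _ [U [U1 AU] <-].
have Uf k : ediam (U k) \is a fin_num.
  by rewrite ge0_fin_numE ?ediam_ge0// (le_lt_trans (U1 k))// ltry.
have D0 k : 0 <= fine (ediam (U k)) by rewrite fine_ge0// ediam_ge0.
apply/lee_addgt0Pr => e e0.
have Ls : 0 < (2 * L) ^+ s by rewrite exprn_gt0// mulr_gt0.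
pose eps := Num.min 1 (e * (2 * L) ^+ s / w).
have eps0 : 0 < eps <= 1.
  by rewrite /eps lt_min ltr01 divr_gt0 ?mulr_gt0//= ge_min lexx.
have epse : w / (2 * L) ^+ s * eps <= e.
  have : eps <= e * (2 * L) ^+ s / w by rewrite /eps ge_min lexx orbT.
  rewrite ler_pdivlMr// => h; rewrite mulrAC ler_pdivrMr//.
  by rewrite mulrC.
have [] := @cube_cover_sum s c r eps (fun k => f @` (U k `&` A))
  (fun k => L * fine (ediam (U k))) r0 eps0 s0.
- by move=> k; rewrite mulr_ge0// ltW.
- move=> k _ _ [x [Ux Ax] <-] [y [Uy Ay] <-].
  rewrite (le_trans (fL _ _ Ax Ay))// ler_pM2l// (le_trans (norm_le_enorm _))//.
  by rewrite -lee_fin fineK ?enorm_le_ediam.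
- move=> _ /cA[x Ax <-]; have [k _ Ukx] := AU _ Ax.
  by exists k => //; exists x.
move=> K hK.
apply: (@le_trans _ _ (\sum_(k < K) hausdorff_weight s (U k) + e%:E)%E); last first.
  rewrite leeD2r// -(big_mkord xpredT (fun k => hausdorff_weight s (U k))).
  by apply: nneseries_lim_ge => k _ _; exact: hausdorff_weight_ge0.
under eq_bigr do rewrite hausdorff_weightE//.
rewrite sumEFin -EFinD lee_fin -/w.
have -> : \sum_(k < K) w * (fine (ediam (U k)) / 2) ^+ s =
    w / (2 * L) ^+ s * \sum_(k < K) (L * fine (ediam (U k))) ^+ s.
  rewrite big_distrr /=; apply: eq_bigr => k _.
  rewrite -mulrA; congr (_ * _); rewrite -exprVn -exprMn; congr (_ ^+ _).
  by field; rewrite gt_eqF.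
apply: (@le_trans _ _ (w / (2 * L) ^+ s *
   (\sum_(k < K) (L * fine (ediam (U k))) ^+ s + eps))); last first.
  by rewrite mulrDr lerD2l.
rewrite -mulrA ler_pM2l// [leRHS]mulrC ler_pdivlMr//.
rewrite -exprMn (_ : r / (12 * L) * (2 * L) = r / 6); last first.
  by field; rewrite gt_eqF.
by rewrite expr_div_n ler_pdivrMr ?exprn_gt0// mulrC.
Qed.

(** [A] is covered by the images of the [N ^ s] cubes of a grid, of diameter
    proportional to [1 / N]. *)
Lemma hausdorff_le_image n s (A : set 'rV[R]_n) (g : 'rV[R]_s -> 'rV[R]_n)
    (L r : R) (c : 'rV[R]_s) :
  (0 < s)%N -> 0 <= L -> 0 < r ->
  (forall x y, `|g x - g y| <= L * `|x - y|) ->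
  A `<=` g @` cube c r ->
  (hausdorff s A <= (unit_ball_volume R s * (n%:R * L * r) ^+ s)%:E)%E.
Proof.
move=> s0 L0 r0 gL Ag; set w := unit_ball_volume R s.
have w0 : 0 < w by exact: unit_ball_volume_gt0.
apply: ge_ereal_sup => _ [delta /= d0 <-].
have nLr0 : 0 <= n%:R * L * r by rewrite !mulr_ge0 ?(ltW r0).
pose N := (Num.truncn (n%:R * L * r / delta)).+1.
have N0 : (0 : R) < N%:R by rewrite ltr0n.
have Nd : n%:R * L * r / N%:R <= delta.
  have q0 : 0 <= n%:R * L * r / delta by rewrite divr_ge0// ltW.
  have /andP[_ /ltW] := truncn_itv q0; rewrite -/N => h.
  by rewrite ler_pdivrMr// [leRHS]mulrC -ler_pdivrMr.
pose B (j : {ffun 'I_s -> 'I_N}) : set 'rV[R]_n :=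
  g @` cube (\row_i (c 0 i + r / N%:R * (j i)%:R)) (r / N%:R).
pose sq := [seq B j | j <- enum {: {ffun 'I_s -> 'I_N}}].
pose U k := nth set0 sq k.
have Bd j : (ediam (B j) <= (n%:R * L * r / N%:R)%:E)%E.
  apply: ge_ereal_sup => z [->|]; first by rewrite lee_fin divr_ge0// ltW.
  move=> [_ [_ [[x xj <-] [y yj <-] ->]]]; rewrite lee_fin.
  rewrite (le_trans (enorm_le_norm _))// -!mulrA ler_wpM2l//.
  rewrite (le_trans (gL _ _))// ler_wpM2l//.
  apply: norm_le_coord => [|i]; first by rewrite divr_ge0// ltW.
  have := xj i; have := yj i; rewrite !mxE ler_norml => /andP[? ?] /andP[? ?].
  by apply/andP; split; lra.
have Ud k : (ediam (U k) <= (n%:R * L * r / N%:R)%:E)%E.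
  rewrite /U; have [ks|ks] := ltnP k (size sq).
    have /mapP[j _ ->] : nth set0 sq k \in sq by rewrite mem_nth.
    exact: Bd.
  by rewrite nth_default// ediam0 lee_fin divr_ge0// ltW.
apply: (@le_trans _ _ (\sum_(k <oo) hausdorff_weight s (U k))%E).
  apply: ereal_inf_lbound; exists U => //; split.
    by move=> k; rewrite (le_trans (Ud k))// lee_fin.
  move=> _ /Ag[x xc <-].
  have rN : 0 < r / N%:R by rewrite divr_gt0.
  have xN i : 0 <= (x 0 i - c 0 i) / (r / N%:R) <= N%:R.
    have /andP[h1 h2] := xc i; apply/andP; split.
      by rewrite divr_ge0 ?subr_ge0// ltW.
    by rewrite ler_pdivrMr// mulrC divfK ?gt_eqF//; lra.
  pose j : {ffun 'I_s -> 'I_N} :=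
    [ffun i => inord (minn (Num.truncn ((x 0 i - c 0 i) / (r / N%:R))) N.-1)].
  exists (index (B j) sq) => //; rewrite /U nth_index; last first.
    by apply/mapP; exists j; rewrite ?mem_enum.
  exists x => // i; rewrite !mxE ffunE inordK ?ltnS ?geq_minr//.
  have /andP[h1 h2] := xN i; set y := _ / (r / N%:R) in h1 h2 *.
  have -> : x 0 i = c 0 i + r / N%:R * y.
    by rewrite /y mulrC divfK ?gt_eqF//; lra.
  have /andP[h3 h4] := truncn_itv h1.
  rewrite -addrA !lerD2l -[X in _ <= _ + X]mulr1 -mulrDr !ler_pM2l//.
  rewrite /minn; case: ltnP => h5; first by rewrite h3 natr1 ltW.
  by rewrite natr1 h2 andbT (le_trans _ h3)// ler_nat.
rewrite (nneseries_split 0 (size sq)) => [|k _]; last exact: hausdorff_weight_ge0.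
rewrite add0n [X in (_ + X)%E]eseries0 => [|k kN _]; last first.
  by rewrite /U nth_default// hausdorff_weight0.
rewrite adde0 big_mkord.
apply: (@le_trans _ _ (\sum_(k < size sq) (w * (n%:R * L * r / N%:R / 2) ^+ s)%:E)%E).
  apply: lee_sum => k _.
  have Uf : ediam (U k) \is a fin_num.
    by rewrite ge0_fin_numE ?ediam_ge0// (le_lt_trans (Ud k))// ltry.
  rewrite hausdorff_weightE// lee_fin ler_pM2l// lerXn2r ?nnegrE//.
  - by rewrite divr_ge0// fine_ge0// ediam_ge0.
  - by rewrite !divr_ge0// ltW.
  - by rewrite ler_pM2r ?invr_gt0// -lee_fin fineK.
rewrite sumEFin sumr_const card_ord /sq size_map -cardE card_ffun !card_ord lee_fin.
rewrite -[leLHS]mulr_natl natrX mulrCA ler_pM2l// -exprMn.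
set q := n%:R * L * r in nLr0 *.
rewrite (_ : N%:R * (q / N%:R / 2) = q / 2); last by field; rewrite gt_eqF.
by rewrite lerXn2r ?nnegrE ?divr_ge0//; lra.
Qed.

End hausdorff_bounds.

(** * Open sets are measurable; the discrete Lebesgue norms *)

Lemma sum_even_odd (R : realType) (f : nat -> \bar R) N :
  (\sum_(0 <= k < N.*2) f k =
   \sum_(m < N) f (m.*2 + 0)%N + \sum_(m < N) f (m.*2 + 1)%N)%E.
Proof.
elim: N => [|N IH]; first by rewrite double0 !big_ord0 big_geq// adde0.
rewrite doubleS 2?big_nat_recr//= IH !big_ord_recr /= addn0 addn1.
by rewrite -!addeA; congr (_ + _)%E; rewrite addeCA.
Qed.

Section metric_outer_measure.
Context {R : realType} {n s : nat}.
Hypothesis s0 : (0 < s)%N.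
Implicit Types A B U X : set 'rV[R]_n.
Local Open Scope ereal_scope.
Local Notation H := (@hausdorff R n s).

Lemma le_ediam A B : A `<=` B -> ediam A <= ediam B.
Proof.
move=> AB; apply: ge_ereal_sup => r [->|[x [y [Ax Ay ->]]]].
  exact: ediam_ge0.
by apply: enorm_le_ediam; exact: AB.
Qed.

Lemma le_hausdorff_weight A B : ediam B \is a fin_num -> A `<=` B ->
  hausdorff_weight s A <= hausdorff_weight s B.
Proof.
move=> Bf AB; have Af : ediam A \is a fin_num.
  rewrite ge0_fin_numE ?ediam_ge0// (le_lt_trans (le_ediam AB))//.
  by rewrite -ge0_fin_numE ?ediam_ge0.
rewrite !hausdorff_weightE// lee_fin ler_pM2l ?unit_ball_volume_gt0//.
rewrite lerXn2r ?nnegrE ?divr_ge0 ?fine_ge0 ?ediam_ge0//.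
by rewrite ler_pM2r ?invr_gt0// fine_le// le_ediam.
Qed.

Lemma hausdorff_pre_separated (eta delta : R) A B :
  (delta < eta)%R -> (forall x y, A x -> B y -> (eta <= `|x - y|)%R) ->
  hausdorff_pre s delta A + hausdorff_pre s delta B <=
  hausdorff_pre s delta (A `|` B).
Proof.
move=> de sep; apply: le_ereal_inf_tmp => _ [U [Ud ABU] <-].
have Uf k : ediam (U k) \is a fin_num.
  by rewrite ge0_fin_numE ?ediam_ge0// (le_lt_trans (Ud k))// ltry.
apply: (@le_trans _ _ (\sum_(k <oo) hausdorff_weight s (U k `&` A) +
                      \sum_(k <oo) hausdorff_weight s (U k `&` B))).
  apply: leeD; apply: ereal_inf_lbound.
  - exists (fun k => U k `&` A) => //; split.
      by move=> k; rewrite (le_trans _ (Ud k))// le_ediam.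
    by move=> x Ax; have [|k _ Ux] := ABU x; [left|exists k].
  - exists (fun k => U k `&` B) => //; split.
      by move=> k; rewrite (le_trans _ (Ud k))// le_ediam.
    by move=> x Ax; have [|k _ Ux] := ABU x; [right|exists k].
rewrite -nneseriesD; try by move=> *; exact: hausdorff_weight_ge0.
apply: lee_nneseries => k _.
  by move=> _; rewrite adde_ge0// hausdorff_weight_ge0.
have [UA|UA] := eqVneq (U k `&` A) set0.
  by rewrite UA hausdorff_weight0 add0e le_hausdorff_weight.
have [UB|UB] := eqVneq (U k `&` B) set0.
  by rewrite UB hausdorff_weight0 adde0 le_hausdorff_weight.
move/set0P : UA => [x [Ux Ax]]; move/set0P : UB => [y [Uy By]].
exfalso; have := sep _ _ Ax By; apply/negP; rewrite -ltNge.
rewrite (le_lt_trans _ de)// (le_trans (norm_le_enorm _))//.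
by rewrite -lee_fin (le_trans (enorm_le_ediam Ux Uy)).
Qed.

Lemma le_hausdorff_pre_delta (d1 d2 : R) A : (d1 <= d2)%R ->
  hausdorff_pre s d2 A <= hausdorff_pre s d1 A.
Proof.
move=> d12; apply: ereal_inf_le_tmp => _ [U [Ud AU] <-].
by exists U => //; split => // k; rewrite (le_trans (Ud k))// lee_fin.
Qed.

(** A cover by sets of diameter smaller than the distance of [A] and [B] splits
    into a cover of [A] and a cover of [B]. *)
Lemma hausdorff_separated (eta : R) A B :
  (0 < eta)%R -> (forall x y, A x -> B y -> (eta <= `|x - y|)%R) ->
  H A + H B <= H (A `|` B).
Proof.
move=> eta0 sep.
have [->|AB] := eqVneq (H (A `|` B)) +oo; first by rewrite leey.
have fin C : C `<=` A `|` B -> H C \is a fin_num.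
  move=> CAB; rewrite ge0_fin_numE ?hausdorff_ge0//.
  by rewrite (le_lt_trans (le_hausdorff _ CAB))// ltey.
have HA := fin _ (@subsetUl _ A B); have HB := fin _ (@subsetUr _ A B).
have key (d1 d2 : R) : (0 < d1)%R -> (0 < d2)%R ->
    hausdorff_pre s d1 A + hausdorff_pre s d2 B <= H (A `|` B).
  move=> d10 d20; pose d := Num.min (Num.min d1 d2) (eta / 2)%R.
  have d0 : (0 < d)%R by rewrite /d !lt_min d10 d20 divr_gt0.
  apply: (@le_trans _ _ (hausdorff_pre s d A + hausdorff_pre s d B)).
    by rewrite leeD// le_hausdorff_pre_delta// /d !ge_min lexx ?orbT.
  apply: (@le_trans _ _ (hausdorff_pre s d (A `|` B))).
    apply: (@hausdorff_pre_separated eta) => //.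
    by rewrite /d gt_min; apply/orP; right; lra.
  by apply: ereal_sup_ubound; exists d.
rewrite -leeBrDr//; apply: ge_ereal_sup => _ [d1 /= d10 <-].
rewrite leeBrDr// addeC.
have p1 : hausdorff_pre s d1 A \is a fin_num.
  rewrite ge0_fin_numE ?hausdorff_pre_ge0// (@le_lt_trans _ _ (H A))//.
    by apply: ereal_sup_ubound; exists d1.
  by rewrite -ge0_fin_numE ?hausdorff_ge0.
rewrite -leeBrDr//; apply: ge_ereal_sup => _ [d2 /= d20 <-].
by rewrite leeBrDr// addeC key.
Qed.

(** Caratheodory's criterion for the open set [U]: the points of [U] at
    distance at least [1 / m.+1] of the complement are separated from it,
    and the shells between consecutive such sets have summable measure since
    every other shell is separated from the previous ones. *)
Lemma open_caratheodory U : open U -> H.-caratheodory U.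
Proof.
move=> oU; apply: le_caratheodory_measurable => X /=.
have [->|XN] := eqVneq (H X) +oo; first by rewrite leey.
pose I m : set 'rV[R]_n := [set x | ball x (m.+1%:R^-1) `<=` U].
have Iinc m k : (m <= k)%N -> I m `<=` I k.
  move=> mk x; apply: subset_trans; apply: le_ball.
  by rewrite lef_pV2 ?posrE ?ltr0n// ler_nat ltnS.
have Isep m x y : I m x -> ~ I m.+1 y ->
    (m.+1%:R^-1 - m.+2%:R^-1 <= `|x - y|)%R.
  move=> Ix Iy; rewrite leNgt; apply/negP => h; apply: Iy => z yz.
  apply: Ix; move: yz; rewrite -!ball_normE /= => yz.
  have -> : (x - z = (x - y) + (y - z))%R by rewrite addrA subrK.
  by have := ltrD h yz; rewrite subrK; apply: le_lt_trans; exact: ler_normD.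
have IU m : I m `<=` U by move=> x; apply; exact: ballxx.
have eta0 m : (0 < m.+1%:R^-1 - m.+2%:R^-1 :> R)%R.
  by rewrite subr_gt0 ltf_pV2 ?posrE ?ltr0n// ltr_nat.
pose S m := X `&` (I m.+1 `\` I m).
have half a M : \sum_(m < M) H (S (m.*2 + a).+1) <= H (X `&` I (M.*2 + a)%N).
  elim: M => [|M IH]; first by rewrite big_ord0 hausdorff_ge0.
  rewrite big_ord_recr /= (le_trans (leeD2r _ IH))//.
  apply: (le_trans (@hausdorff_separated _ _ _ (eta0 (M.*2 + a)%N) _)).
    by move=> x y [_ Ix] [_ [_ Iy]]; exact: Isep.
  apply: le_hausdorff => x [[Xx Ix]|[Xx [Ix _]]]; split => //.
    by apply: Iinc Ix; rewrite doubleS !addSn !leqW.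
have sumS N : \sum_(0 <= k < N) H (S k.+1) <= 2%:E * H X.
  apply: (@le_trans _ _ (\sum_(0 <= k < N.*2) H (S k.+1))).
    rewrite (@big_cat_nat _ _ _ N 0 N.*2)//= ?leeDl//.
      by apply: sume_ge0 => *; exact: hausdorff_ge0.
    by rewrite -addnn leq_addr.
  rewrite (sum_even_odd (fun k => H (S k.+1))).
  rewrite [X in X * _](_ : 2%:E = 1 + 1)//.
  rewrite ge0_muleDl// mul1e.
  by apply: leeD; apply: (le_trans (half _ _)); exact: le_hausdorff.
pose f k := H (S k.+1).
have f0 k : true -> 0 <= f k by move=> _; exact: hausdorff_ge0.
have fs : \sum_(k <oo) f k < +oo.
  apply: (@le_lt_trans _ _ (2%:E * H X)).
    by apply: lime_le; [apply: is_cvg_nneseries => *; exact: f0|exact: nearW].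
  rewrite -ge0_fin_numE ?mule_ge0 ?hausdorff_ge0// fin_numM//.
  by rewrite ge0_fin_numE ?hausdorff_ge0// ltey.
have := nneseries_tail_cvg fs f0.
have HX : H X \is a fin_num by rewrite ge0_fin_numE ?hausdorff_ge0// ltey.
move=> tl; have tl2 : H X + \sum_(N <= k <oo) f k @[N --> \oo] --> H X.
  rewrite -[X in _ --> X]adde0; apply: cvgeD => //; last exact: cvg_cst.
  by rewrite fin_num_adde_defr.
apply: (cvge_to_ge tl2); apply: nearW => j.
have XU : H (X `&` U) <= H (X `&` I j.+1) + \sum_(j <= k <oo) f k.
  apply: (@le_trans _ _ (H ((X `&` I j.+1) `|` \bigcup_(k in ~` `I_j) S k.+1))).
    apply: le_hausdorff => x [Xx Ux].
    have [m Im] : exists m, `[< I m x >].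
      have := oU; rewrite openE => /(_ _ Ux); rewrite /interior nbhs_ballP.
      move=> [r /= r0 rU]; exists (Num.truncn (r^-1)); apply/asboolP.
      apply: subset_trans rU; apply: le_ball.
      have ri0 : (0 <= r^-1)%R by rewrite invr_ge0 ltW.
      have /andP[_ /ltW h] := truncn_itv ri0.
      by rewrite -[leRHS]invrK lef_pV2 ?posrE ?invr_gt0 ?ltr0n.
    case: (ex_minnP (ex_intro (fun m => `[< I m x >] = true) m Im)) => p.
    move=> /asboolP Ip pmin.
    have [pj|jp] := leqP p j.+1; first by left; split => //; exact: Iinc Ip.
    right; case: p => [//|[//|p]] in Ip pmin jp *.
    exists p => /=; first by apply/negP; rewrite -leqNgt.
    split => //; split => // Ip1.
    by have := pmin p.+1; rewrite ltnn => /(_ (asboolT Ip1)).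
  have := outer_measure_sigma_subadditive_tail (@hausdorff R n s) j
    (fun k => S k.+1).
  move=> /(leeD2l (H (X `&` I j.+1))); apply: le_trans.
  exact: outer_measureU2.
rewrite (le_trans (leeD2r _ XU))// addeAC leeD2r//.
apply: (le_trans (@hausdorff_separated _ _ _ (eta0 j.+1) _)).
  by move=> x y [_ Ix] [_ Uy]; apply: Isep => // /IU.
by apply: le_hausdorff => x [[]|[]].
Qed.

End metric_outer_measure.

Lemma integral_sum_indic_ge (R : realType) (disp : measure_display)
    (X : measurableType disp) (mu : {measure set X -> \bar R}) (T : finType)
    (A : T -> set X) (a : T -> R) (c : R) :
  (forall K, measurable (A K)) -> (forall K, 0 <= a K) ->
  (forall K, (c%:E <= mu (A K))%E) ->
  ((c * \sum_K a K)%:E <=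
   \int[mu]_x \sum_(K : T) (a K)%:E * (\1_(A K) x)%:E)%E.
Proof.
move=> mA a0 cA; rewrite ge0_integral_sum//; last 2 first.
- move=> K; apply: measurable_funeM; apply/measurable_EFinP.
  exact: measurable_indic.
- by move=> K x _; rewrite lee_fin mulr_ge0.
rewrite mulr_sumr -sumEFin; apply: lee_sum => K _.
rewrite ge0_integralZl_EFin//; last first.
  by apply/measurable_EFinP; exact: measurable_indic.
by rewrite integral_indic// setIT EFinM muleC lee_wpmul2l// lee_fin.
Qed.

Section discrete_norms.
Context {R : realType} {d : nat} {Omega : set 'rV[R]_d} {T E : finType}.
Variable M : mesh Omega T E.
Hypothesis d0 : (0 < d)%N.
Hypothesis cell_disj : forall K L x, cell M K x -> cell M L x -> K = L.
Implicit Types u : T -> R.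

Lemma cellwise_in u K x : cell M K x -> cellwise M u x = u K.
Proof.
move=> Kx; rewrite /cellwise (bigD1 K)//= indicE mem_set// mulr1.
rewrite big1 ?addr0// => L LK; rewrite indicE memNset ?mulr0// => Lx.
by move: LK; rewrite (cell_disj Lx Kx) eqxx.
Qed.

Lemma cellwise_out u x : (forall K, ~ cell M K x) -> cellwise M u x = 0.
Proof.
by move=> Kx; rewrite /cellwise big1// => L _; rewrite indicE memNset ?mulr0.
Qed.

Lemma norm0_oo_le u (c : R) : 0 <= c -> (forall K, `|u K| <= c) ->
  (norm0 M +oo u <= c%:E)%E.
Proof.
move=> c0 uc; rewrite /norm0 Lnorm.unlock /=; case: ifPn => _; last by rewrite lee_fin.
apply/ess_sup_inf.ess_supP; apply: nearW => x /=; rewrite lee_fin /patch.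
case: ifP => _; last by rewrite normr0.
have [[K Kx]|Kx] := pselect (exists K, cell M K x).
  by rewrite (cellwise_in u Kx).
by rewrite cellwise_out ?normr0// => K ?; apply: Kx; exists K.
Qed.

(** As the cells are disjoint, the integrand is a combination of their
    indicators. *)
Lemma norm0_d_ge u (c : R) : 0 <= c ->
  (forall K, (c%:E <= hausdorff d (cell M K))%E) ->
  (((c * \sum_K `|u K| ^+ d) `^ d%:R^-1)%:E <= norm0 M d%:R%:E u)%E.
Proof.
move=> c0 cK; rewrite /norm0.
have dR : (0 : R) < d%:R by rewrite ltr0n.
have mK K : measurable (cell M K : set (caratheodory_type (lebesgue_outer R d))).
  exact: (open_caratheodory d0 (@cell_open _ _ _ _ _ M K)).
have {cK} : forall K, (c%:E <= lebesgue_Rd R d (cell M K))%E by [].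
move: (lebesgue_Rd R d) => mu cK.
rewrite Lnorm.unlock -poweR_EFin; apply: gt0_ler_poweR.
- by rewrite invr_ge0 ltW.
- by rewrite in_itv /= leey andbT lee_fin mulr_ge0// sumr_ge0.
- by rewrite in_itv /= leey andbT; apply: integral_ge0 => x _; rewrite lee_fin powR_ge0.
have -> : (\int[mu]_x
    `|(EFin \o ((cellwise M u) \_ Omega)) x| `^ d%:R =
  \int[mu]_x
     \sum_(K : T) (`|u K| ^+ d)%:E * (\1_(cell M K) x)%:E)%E.
  apply: eq_integral => x _ /=; rewrite powR_mulrn//.
  have [[K Kx]|Kx] := pselect (exists K, cell M K x).
    rewrite /patch mem_set; last exact: (@cell_sub _ _ _ _ _ M K).
    rewrite (cellwise_in u Kx) (bigD1 K)//= indicE mem_set// mule1.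
    rewrite big1 ?adde0// => L LK; rewrite indicE memNset ?mule0// => Lx.
    by move: LK; rewrite (cell_disj Lx Kx) eqxx.
  have {}Kx K : ~ cell M K x by move=> ?; apply: Kx; exists K.
  rewrite big1; last by move=> K _; rewrite indicE memNset ?mule0.
  by rewrite /patch; case: ifP => _; rewrite ?cellwise_out// normr0 expr0n gtn_eqF.
by apply: integral_sum_indic_ge => // K; rewrite exprn_ge0.
Qed.

End discrete_norms.

(** * Hyperplanes and null sets *)

Section hyperplanes.
Context {R : realType} {n : nat}.
Implicit Types (a x y v : 'rV[R]_n.+1) (w : 'rV[R]_n) (i : 'I_n.+1).

Lemma dotpC a x : dotp a x = dotp x a.
Proof. by apply: eq_bigr => i _; rewrite mulrC. Qed.

Lemma dotpDr a x y : dotp a (x + y) = dotp a x + dotp a y.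
Proof. by rewrite -big_split; apply: eq_bigr => i _; rewrite mxE mulrDr. Qed.

Lemma dotpZr a (k : R) x : dotp a (k *: x) = k * dotp a x.
Proof. by rewrite mulr_sumr; apply: eq_bigr => i _; rewrite mxE mulrCA. Qed.

Lemma dotpBr a x y : dotp a (x - y) = dotp a x - dotp a y.
Proof. by rewrite -scaleN1r dotpDr dotpZr mulN1r. Qed.

Lemma dotp_le a x : `|dotp a x| <= (\sum_i `|a 0 i|) * `|x|.
Proof.
rewrite mulr_suml (le_trans (ler_norm_sum _ _ _))//; apply: ler_sum => i _.
by rewrite normrM ler_wpM2l// coord_le_norm.
Qed.

Definition insert0 i w : 'rV[R]_n.+1 :=
  \row_k if unlift i k is Some j then w 0 j else 0.

Lemma insert0_lift i w j : insert0 i w 0 (lift i j) = w 0 j.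
Proof. by rewrite mxE liftK. Qed.

Lemma insert0B i w w' : insert0 i w - insert0 i w' = insert0 i (w - w').
Proof.
by apply/rowP => k; rewrite !mxE; case: unliftP => [j|] _; rewrite ?mxE ?subrr.
Qed.

Lemma norm_insert0 i w : `|insert0 i w| <= `|w|.
Proof.
apply: norm_le_coord => // k; rewrite mxE; case: unliftP => [j|] _.
  exact: coord_le_norm.
by rewrite normr0.
Qed.

Lemma norm_col' i x : `|col' i x| <= `|x|.
Proof. by apply: norm_le_coord => // j; rewrite mxE coord_le_norm. Qed.

Lemma row_nz v : v != 0 -> exists i, v 0 i != 0.
Proof.
move=> v0; apply/existsP; rewrite -negb_forall; apply: contra v0 => /forallP h.
by apply/eqP/rowP => i; rewrite mxE; exact/eqP.
Qed.

(** [f] drops a coordinate whose coefficient in the equation of the hyperplane is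
    nonzero, and [g] recovers it by solving the equation. *)
Lemma hyperplane_param a (b : R) : a != 0 ->
  exists (f : 'rV[R]_n.+1 -> 'rV[R]_n) (g : 'rV[R]_n -> 'rV[R]_n.+1) (L : R),
  [/\ 0 < L, forall x y, `|f x - f y| <= `|x - y|,
      forall w w', `|g w - g w'| <= L * `|w - w'|,
      forall w, dotp a (g w) = b /\ f (g w) = w &
      forall x, dotp a x = b -> g (f x) = x].
Proof.
move=> /row_nz[i ai].
pose e : 'rV[R]_n.+1 := delta_mx 0 i.
have ae : dotp a e = a 0 i.
  rewrite /dotp (bigD1 i)//= mxE !eqxx mulr1 big1 ?addr0// => k ki.
  by rewrite mxE eqxx (negbTE ki) mulr0.
have eE : forall k, e 0 k = (k == i)%:R by move=> k; rewrite mxE eqxx.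
pose c w : R := (b - dotp a (insert0 i w)) / a 0 i.
pose g w := insert0 i w + c w *: e.
pose A := \sum_i `|a 0 i|.
have A0 : 0 <= A by exact: sumr_ge0.
have ag w : dotp a (g w) = b.
  by rewrite /g dotpDr dotpZr ae /c divfK// addrC subrK.
have fg w : col' i (g w) = w.
  apply/rowP => j; rewrite mxE /g mxE insert0_lift mxE eE.
  by rewrite eq_sym (negbTE (neq_lift _ _)) mulr0 addr0.
have e1 : `|e| <= 1.
  by apply: norm_le_coord => // k; rewrite eE; case: eqP; rewrite ?normr1 ?normr0.
exists (col' i), g, (1 + A / `|a 0 i|); split => //.
- by rewrite ltr_pwDl// divr_ge0.
- move=> x y; rewrite (_ : col' i x - col' i y = col' i (x - y)) ?norm_col'//.
  by apply/rowP => j; rewrite !mxE.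
- move=> w w'.
  have -> : g w - g w' = insert0 i (w - w') + (c w - c w') *: e.
    by rewrite -insert0B scalerBl /g opprD addrACA.
  rewrite (le_trans (ler_normD _ _))// mulrDl mul1r lerD ?norm_insert0//.
  rewrite normrZ (le_trans (ler_piMr _ e1))//.
  have -> : c w - c w' = - (dotp a (insert0 i (w - w')) / a 0 i).
    by rewrite -insert0B dotpBr /c; field.
  rewrite normrN normrM normfV mulrAC ler_wpM2r ?invr_ge0//.
  by rewrite (le_trans (dotp_le _ _))// ler_wpM2l// norm_insert0.
- move=> x ax.
  have h : dotp a (g (col' i x) - x) = 0.
    by rewrite dotpBr ag ax subrr.
  have lj j : (g (col' i x) - x) 0 (lift i j) = 0.
    have /rowP/(_ j) := fg (col' i x); rewrite !mxE => ->.
    by rewrite subrr.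
  apply/eqP; rewrite -subr_eq0; apply/eqP/rowP => k; rewrite [RHS]mxE.
  case: (unliftP i k) => [j ->|->]; first exact: lj.
  move: h; rewrite /dotp (bigD1 i)//= big1 ?addr0; last first.
    by move=> l; case: (unliftP i l) => [j -> _|->]; rewrite ?lj ?mulr0 ?eqxx.
  by move/eqP; rewrite mulf_eq0 (negbTE ai) => /eqP.
Qed.

Hypothesis n0 : (0 < n)%N.

Lemma hausdorff_hyperplane_gt0 (A : set 'rV[R]_n.+1) (a : 'rV[R]_n.+1) (b r : R) z :
  a != 0 -> 0 < r -> dotp a z = b ->
  (forall x, `|x - z| < r -> dotp a x = b -> A x) ->
  (0 < hausdorff n A)%E.
Proof.
move=> /hyperplane_param-/(_ b)[f [g [L [L0 f1 gL gP fP]]]] r0 zb zA.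
pose S := A `&` [set x | dotp a x = b].
apply: (@lt_le_trans _ _ (hausdorff n S)); last first.
  by apply: le_hausdorff => x [].
have rho0 : 0 < r / (2 * L) by rewrite divr_gt0// mulr_gt0.
apply: lt_le_trans (@hausdorff_ge_cube _ _ _ S f 1 _ (f z) n0 ltr01 rho0 _ _).
- by rewrite lte_fin mulr_gt0 ?unit_ball_volume_gt0// exprn_gt0// divr_gt0.
- by move=> x y _ _; rewrite mul1r.
- move=> w hw; exists (g w); last by case: (gP w).
  split; last by case: (gP w).
  apply: zA; last by case: (gP w).
  rewrite -{1}(fP z zb) (le_lt_trans (gL _ _))//.
  rewrite mulrC -ltr_pdivlMr//.
  apply: (@le_lt_trans _ _ (r / (2 * L))); last first.
    by rewrite ltr_pM2l// ltf_pV2 ?posrE ?mulr_gt0// ltr_pMl// ltr1n.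
  apply: norm_le_coord => [|j]; first exact: ltW.
  have := hw j; rewrite !mxE ler_norml => /andP[? ?].
  by apply/andP; split; lra.
Qed.

Lemma hausdorff_hyperplane_fin (A : set 'rV[R]_n.+1) (a : 'rV[R]_n.+1) (b m : R) :
  a != 0 -> (forall x, A x -> dotp a x = b) -> (forall x, A x -> `|x| <= m) ->
  hausdorff n A \is a fin_num.
Proof.
move=> /hyperplane_param-/(_ b)[f [g [L [L0 f1 gL gP fP]]]] Ab Am.
pose m' := `|m| + `|f 0| + 1.
have m0 : 0 < 2 * m' by rewrite mulr_gt0// ltr_wpDl// addr_ge0.
rewrite ge0_fin_numE ?hausdorff_ge0//.
apply: (le_lt_trans (@hausdorff_le_image _ _ _ A g L _ (const_mx (- m'))
  n0 (ltW L0) m0 gL _)); last exact: ltry.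
move=> x Ax; exists (f x); last by rewrite fP// Ab.
have fx : `|f x| <= m'.
  rewrite -(subrK (f 0) (f x)) (le_trans (ler_normD _ _))// /m'.
  rewrite -[leRHS]addrA [leRHS]addrCA [leRHS]addrC.
  have := f1 x 0; rewrite subr0; have := Am x Ax; have := ler_norm m; lra.
move=> j; have := le_trans (coord_le_norm _ j) fx; rewrite mxE ler_norml => /andP[? ?].
by apply/andP; split; lra.
Qed.

(** A set of vanishing [n]-dimensional measure does not separate an open convex
    set: the segments from the points near [x] with direction [y - x] all meet
    both closed sets at a common point, so that the projection of the
    separator along [y - x] contains a cube. *)
Lemma hausdorff_separator_gt0 (U V W : set 'rV[R]_n.+1) x y :
  open U -> (forall p q (t : R), U p -> U q -> 0 <= t <= 1 ->
    U (p + t *: (q - p))) ->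
  closed V -> closed W -> U `<=` V `|` W -> U x -> ~ W x -> U y -> ~ V y ->
  (0 < hausdorff n (V `&` W `&` U))%E.
Proof.
move=> oU cU cV cW UVW Ux Wx Uy Vy.
have [v vE] : exists v : 'rV[R]_n.+1, v = y - x by exists (y - x).
have Vx : V x by case: (UVW _ Ux).
have /row_nz[i vi] : v != 0.
  by rewrite vE subr_eq0; apply/eqP => yx; apply: Vy; rewrite yx.
pose pr (z : 'rV[R]_n.+1) : 'rV[R]_n := col' i (z - (z 0 i / v 0 i) *: v).
have prB z z' : pr z - pr z' = pr (z - z').
  by apply/rowP => j; rewrite !mxE; field.
have prv z (t : R) : pr (z + t *: v) = pr z.
  by apply/rowP => j; rewrite !mxE; field.
have prI w : pr (insert0 i w) = w.
  by apply/rowP => j; rewrite !mxE liftK unlift_none !mul0r subr0.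
pose L := 1 + `|v| / `|v 0 i|.
have L0 : 0 < L by rewrite ltr_pwDl// divr_ge0.
have prL z z' : `|pr z - pr z'| <= L * `|z - z'|.
  rewrite prB /pr (le_trans (norm_col' _ _))// (le_trans (ler_normB _ _))//.
  rewrite mulrDl mul1r lerD2l normrZ normrM normfV.
  rewrite mulrAC [leRHS]mulrAC ler_wpM2r ?invr_ge0// mulrC ler_wpM2l//.
  exact: coord_le_norm.
have nbx : nbhs x (U `&` ~` W).
  apply: filterI; first exact: open_nbhs_nbhs.
  by apply: open_nbhs_nbhs; split => //; exact: closed_openC.
have nby : nbhs y (U `&` ~` V).
  apply: filterI; first exact: open_nbhs_nbhs.
  by apply: open_nbhs_nbhs; split => //; exact: closed_openC.
move: nbx nby; rewrite !nbhs_ballP => -[r1 /= r10 xr] [r2 /= r20 yr].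
pose r := Num.min r1 r2.
have r0 : 0 < r by rewrite lt_min r10.
have rho0 : 0 < r / 2 by rewrite divr_gt0.
apply: lt_le_trans (@hausdorff_ge_cube _ _ _ _ pr L _ (pr x) n0 L0 rho0 _ _).
- by rewrite lte_fin mulr_gt0 ?unit_ball_volume_gt0// exprn_gt0// divr_gt0// mulr_gt0.
- by move=> p q _ _; exact: prL.
- move=> w hw.
  pose p := x + insert0 i (w - pr x).
  have px : `|p - x| < r.
    rewrite /p addrC addKr (le_lt_trans (norm_insert0 _ _))//.
    apply: (@le_lt_trans _ _ (r / 2)); last by lra.
    apply: norm_le_coord => [|j]; first exact: ltW.
    have := hw j; rewrite !mxE ler_norml => /andP[? ?].
    by apply/andP; split; lra.
  have prp : pr p = w.
    have : pr p - pr x = w - pr x by rewrite prB /p addrC addKr prI.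
    by move=> /(congr1 (fun z => z + pr x)); rewrite !subrK.
  have [Up Wp] : U p /\ ~ W p.
    apply: xr; rewrite -ball_normE /= distrC (lt_le_trans px)//.
    by rewrite ge_min lexx.
  have [Uq Vq] : U (p + v) /\ ~ V (p + v).
    apply: yr; rewrite -ball_normE /= distrC.
    rewrite (_ : p + v - y = p - x); last by rewrite vE; apply/rowP => k; rewrite !mxE; ring.
    by rewrite (lt_le_trans px)// ge_min lexx orbT.
  have Ut (t : R) : 0 <= t <= 1 -> U (p + t *: v).
    move=> t01; have := cU _ _ _ Up Uq t01.
    by rewrite (_ : p + v - p = v)// addrAC subrr add0r.
  have ct : continuous (fun t : R => p + t *: v).
    move=> t; apply: cvgD; first exact: cvg_cst.
    exact: scalel_continuous.
  have [[t [t01 [Vt Wt]]]|none] := pselect (exists t : R, `[0, 1]%classic t /\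
      (V (p + t *: v) /\ W (p + t *: v))).
    exists (p + t *: v); last by rewrite prv.
    by split => //; apply: Ut; move: t01; rewrite /= in_itv.
  exfalso; have := @segment_connected R 0 1.
  pose f := fun t : R => p + t *: v.
  move=> /(_ (`[0, 1] `&` f @^-1` V)%classic); rewrite /f.
  have h : (`[0, 1]%classic : set R) 1 by rewrite /= in_itv /= ler01 lexx.
  move=> H; have : (`[0, 1] `&` f @^-1` V)%classic 1.
    rewrite H//.
    + exists 0; split; first by rewrite /= in_itv /= ler01 lexx.
      rewrite /= scale0r addr0; have [//|/Wp] := UVW _ Up; by [].
    + exists (f @^-1` (~` W)).
        by apply: open_comp => [t _|]; [exact: ct|exact: closed_openC].
      apply/seteqP; split => t [t01 ?]; split => //.
        by move=> Wt; apply: none; exists t.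
      have t1 : 0 <= t <= 1 by move: t01; rewrite /= in_itv.
      by have [//|//] := UVW _ (Ut t t1).
    + by exists (f @^-1` V) => //; apply: preimage_closed => // t _; exact: ct.
  by move=> [_ /=]; rewrite /f scale1r.
Qed.

End hyperplanes.

(** * Geometry of regular meshes *)

Section mesh_geometry.
Context {R : realType} {n : nat} {Omega : set 'rV[R]_n.+1} {T E : finType}.
Variable M : mesh Omega T E.
Hypothesis n0 : (0 < n)%N.
Hypothesis bO : bounded_set Omega.
Local Notation H := (@hausdorff R n.+1 n).
Local Notation center := Defs.center.
Implicit Types (K L : T) (e : E).

Lemma face_sub_bdry K e : e \in faces_of M K ->
  closure (face M e) `<=` bdry (cell M K).
Proof.
by move=> eK x xe; rewrite bdry_cell; exists e.
Qed.

Lemma bdry_cell_notin K x : bdry (cell M K) x -> ~ cell M K x.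
Proof.
by move=> [_ Kx] Kx'; apply: Kx; apply: open_nbhs_nbhs; split=> //; exact: cell_open.
Qed.

(** The source of all contradictions with null intersections: a face is
    relatively open in its hyperplane. *)
Lemma face_meets_open_gt0 e (U : set 'rV[R]_n.+1) x :
  open U -> U x -> face M e x -> (0 < H (face M e `&` U))%E.
Proof.
move=> oU Ux; have [a [b [a0 [W oW fW]]]] := face_open M e.
rewrite fW => -[Wx xb].
have : nbhs x (W `&` U) by apply: filterI; exact: open_nbhs_nbhs.
rewrite nbhs_ballP => -[r /= r0 xr].
apply: (hausdorff_hyperplane_gt0 n0 a0 r0 xb) => y yx yb.
have [] : (W `&` U) y; last by split.
by apply: xr; rewrite -ball_normE /= distrC.
Qed.

Lemma cell_bdry_disj K L x :
  H (closure (cell M K) `&` bdry (cell M L)) = 0%E ->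
  cell M K x -> ~ bdry (cell M L) x.
Proof.
move=> H0 Kx; rewrite bdry_cell => -[e /= eL xe].
have /(_ (cell M K))[|y [ye Ky]] := xe.
  by apply: open_nbhs_nbhs; split => //; exact: cell_open.
have := face_meets_open_gt0 (@cell_open _ _ _ _ _ M K) Ky ye.
rewrite ltNge -H0 => /negP; apply.
apply: le_hausdorff => z [ez Kz]; split; first exact: subset_closure.
by apply: (face_sub_bdry eL); exact: subset_closure.
Qed.

Lemma cell_sub_of_disj K L x : cell M K x -> cell M L x ->
  (forall y, cell M K y -> ~ bdry (cell M L) y) -> cell M K `<=` cell M L.
Proof.
move=> Kx Lx KL; have := @cell_connected _ _ _ _ _ M K.
move=> /(_ (cell M K `&` cell M L)) <-.
- by move=> y [].
- by exists x.
- by exists (cell M L) => //; exact: cell_open.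
- exists (closure (cell M L)); first exact: closed_closure.
  apply/seteqP; split => y [Ky Ly]; split => //; first exact: subset_closure.
  apply: contrapT => Ly'; apply: (KL y Ky); split => //.
  by move=> /interior_subset.
Qed.

(** When two cells overlap, the intersections of each with the boundary of the
    other are null, hence empty as a face meeting an open set does so in positive
    measure. By connectedness each cell then contains the other. *)
Lemma cell_disj K L x : cell M K x -> cell M L x -> K = L.
Proof.
move=> Kx Lx; apply/eqP/negPn/negP => KL.
have [[H1 H2]|[_ H1]] := cells_meet M KL.
  move: KL; rewrite -(inj_eq (@cell_inj _ _ _ _ _ M)) => /eqP; apply.
  apply/seteqP; split; apply: (@cell_sub_of_disj _ _ x) => // y.
    exact: cell_bdry_disj.
  by apply: cell_bdry_disj; rewrite setIC.
have : (closure (cell M K) `&` closure (cell M L)) x.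
  by split; exact: subset_closure.
rewrite H1 => -[e [eK _] xe].
exact: (bdry_cell_notin (face_sub_bdry eK xe)).
Qed.

Lemma cell_closure_disj K L x : cell M K x -> closure (cell M L) x -> K = L.
Proof.
move=> Kx /(_ (cell M K))[|y [Ly Ky]]; last exact: cell_disj Ky Ly.
by apply: open_nbhs_nbhs; split => //; exact: cell_open.
Qed.

Definition adj : rel T := fun K L =>
  (L != K) && [exists e, (e \in faces_of M K) && (e \in faces_of M L)].

Definition touches (U : set 'rV[R]_n.+1) K : bool :=
  `[< cell M K `&` U !=set0 >].

Lemma closure_touches (U : set 'rV[R]_n.+1) K x :
  open U -> closure (cell M K) x -> U x -> touches U K.
Proof.
move=> oU Kx Ux; apply/asboolP; apply: Kx.
by apply: open_nbhs_nbhs.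
Qed.

Lemma null_bigcup (I : finType) (F : I -> set 'rV[R]_n.+1) :
  (forall i, H (F i) = 0%E) -> H (\bigcup_i F i) = 0%E.
Proof.
move=> F0; have -> : \bigcup_i F i = \big[setU/set0]_(i : I) F i.
  by apply/seteqP; split => x; rewrite -bigcup_seq => -[i _ Fi]; exists i => //=;
    exact: mem_index_enum.
apply: (big_ind (fun A => H A = 0%E)) => [|A B A0 B0|i _] //.
apply/eqP; rewrite eq_le hausdorff_ge0 andbT.
by have := outer_measureU2 (@hausdorff R n.+1 n) A B; rewrite /= A0 B0 adde0.
Qed.

(** The cells meeting an open convex set are connected through faces: otherwise
    two families of cells without common face would cover it, and the
    intersection of their closures, which is null in dimension [n], would
    separate it. *)
Lemma cells_chain (U : set 'rV[R]_n.+1) K L :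
  open U -> (forall p q (t : R), U p -> U q -> 0 <= t <= 1 ->
    U (p + t *: (q - p))) -> U `<=` Omega ->
  touches U K -> touches U L ->
  connect (fun A B => [&& adj A B, touches U A & touches U B]) K L.
Proof.
move=> oU cU UO UK UL; set r := (X in connect X).
apply/negPn/negP => KL.
pose V := \bigcup_(B in [set B | connect r K B]) closure (cell M B).
pose W := \bigcup_(B in [set B | ~~ connect r K B]) closure (cell M B).
have clo (D : set T) : closed (\bigcup_(B in D) closure (cell M B)).
  by apply: closed_bigcup => [|B _]; [exact: finite_finset|exact: closed_closure].
have UVW : U `<=` V `|` W.
  move=> x Ux; have : closure Omega x by apply: subset_closure; exact: UO.
  rewrite (cells_cover M) => -[B _ Bx].
  by have [KB|KB] := boolP (connect r K B); [left|right]; exists B.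
move/asboolP: (UK) => [a [Ka Ua]]; move/asboolP: (UL) => [b [Lb Ub]].
have Wa : ~ W a.
  move=> [B /= KB Ba]; move: KB; rewrite -(cell_closure_disj Ka Ba).
  by rewrite connect0.
have Vb : ~ V b.
  by move=> [B /= KB Bb]; move: KL; rewrite (cell_closure_disj Lb Bb) KB.
have := hausdorff_separator_gt0 n0 oU cU (clo _) (clo _) UVW Ua Wa Ub Vb.
rewrite ltNge => /negP; apply.
pose N (p : T * T) : set 'rV[R]_n.+1 :=
  if `[< H (closure (cell M p.1) `&` bdry (cell M p.2)) = 0%E >]
  then closure (cell M p.1) `&` bdry (cell M p.2) else set0.
have N0 p : H (N p) = 0%E.
  by rewrite /N; case: asboolP => // _; exact: hausdorff0.
rewrite -(null_bigcup N0); apply: le_hausdorff => x [[[B KB Bx] [C KC Cx]] Ux].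
have BC : B != C by apply: contraNN KC => /eqP <-.
have UB := closure_touches oU Bx Ux; have UC := closure_touches oU Cx Ux.
have [[H1 _]|[[e [eB eC]] _]] := cells_meet M BC; last first.
  exfalso; move/negP: KC; apply; apply: connect_trans KB _.
  apply: connect1; rewrite /r UB UC !andbT /adj eq_sym BC /=.
  by apply/existsP; exists e; rewrite eB eC.
exists (B, C) => //; rewrite /N asboolT//; split => //=; split => //.
move=> /interior_subset Cx'; move/eqP: BC; apply; apply/esym.
exact: cell_closure_disj Cx' Bx.
Qed.

Lemma closure_norm_le (A : set 'rV[R]_n.+1) c (r : R) :
  (forall x, A x -> `|x - c| <= r) -> forall x, closure A x -> `|x - c| <= r.
Proof.
move=> Ar x Ax; apply/ler_addgt0Pr => e e0.
have [y [Ay]] := Ax _ (nbhsx_ballx x e e0); rewrite -ball_normE /= => xy.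
rewrite (_ : x - c = (y - c) + (x - y)); last by rewrite [RHS]addrC addrA subrK.
by rewrite (le_trans (ler_normD _ _))// lerD ?Ar// ltW.
Qed.

Lemma Omega_bound : exists m : R, forall x, Omega x -> `|x| <= m.
Proof. by move: bO => [m [_ hm]]; exists (m + 1); apply: hm; rewrite ltrDl. Qed.

Local Notation h := (mesh_size M).

Lemma enorm_le_size K (x y : 'rV[R]_n.+1) :
  cell M K x -> cell M K y -> enorm (x - y) <= h.
Proof.
move=> Kx Ky; have [m Om] := Omega_bound.
have fin : ediam (cell M K) \is a fin_num.
  rewrite ge0_fin_numE ?ediam_ge0// (@le_lt_trans _ _ (n.+1%:R * (`|m| + `|m|))%:E)%E//.
    apply: ge_ereal_sup => z [->|]; first by rewrite lee_fin mulr_ge0// addr_ge0.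
    move=> [p [q [/cell_sub/Om pm /cell_sub/Om qm ->]]]; rewrite lee_fin.
    rewrite (le_trans (enorm_le_norm _))// ler_wpM2l// (le_trans (ler_normB _ _))//.
    by rewrite lerD// (le_trans _ (ler_norm m)).
  exact: ltry.
apply: (@le_trans _ _ (fine (ediam (cell M K)))).
  by rewrite -lee_fin fineK//; exact: enorm_le_ediam.
exact: (le_bigmax _ (fun K => fine (ediam (cell M K)))).
Qed.

Lemma closure_cell_near K (x : 'rV[R]_n.+1) :
  closure (cell M K) x -> `|x - center M K| <= h.
Proof.
apply: closure_norm_le => y Ky; rewrite (le_trans (norm_le_enorm _))//.
exact: enorm_le_size Ky (center_in M K).
Qed.

Lemma mesh_size_gt0 K : 0 < h.
Proof.
have : nbhs (center M K) (cell M K).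
  by apply: open_nbhs_nbhs; split; [exact: cell_open|exact: center_in].
rewrite nbhs_ballP => -[r /= r0 cr].
pose v : 'rV[R]_n.+1 := const_mx (r / 2).
have vr : `|v| <= r / 2.
  apply: norm_le_coord => [|i]; first by rewrite divr_ge0// ltW.
  by rewrite mxE ger0_norm// divr_ge0// ltW.
have vK : cell M K (center M K + v).
  apply: cr; rewrite -ball_normE /= opprD addrA subrr sub0r normrN.
  by rewrite (le_lt_trans vr)//; lra.
have := enorm_le_size vK (center_in M K); apply: lt_le_trans.
rewrite (lt_le_trans _ (norm_le_enorm _))// addrC addKr.
rewrite (lt_le_trans _ (coord_le_norm _ 0))// mxE normr_gt0 gt_eqF//.
by rewrite divr_gt0.
Qed.

Section regular.
Variables mu lambda : R.
Hypothesis reg : regular_mesh M mu lambda.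
Hypotheses (mu0 : 0 < mu) (lambda0 : 0 < lambda).

Lemma eball_sub_cell K (x : 'rV[R]_n.+1) :
  enorm (x - center M K) < mu * h -> cell M K x.
Proof.
move=> xK; have := reg.1 K x (center M K) xK (center_in M K) 0.
by rewrite lexx ler01 subr0 scale1r scale0r addr0; exact.
Qed.

Lemma ball_sub_cell K (x : 'rV[R]_n.+1) :
  `|x - center M K| < mu * h / n.+1%:R -> cell M K x.
Proof.
rewrite ltr_pdivlMr ?ltr0n// mulrC => xK; apply: eball_sub_cell.
exact: le_lt_trans (enorm_le_norm _) xK.
Qed.

Lemma centers_separated K L : K != L ->
  mu * h / n.+1%:R <= `|center M K - center M L|.
Proof.
move=> KL; rewrite leNgt; apply: contra KL => /ball_sub_cell KL.
by apply/eqP; exact: cell_disj (center_in M K) KL.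
Qed.

Lemma cell_volume_ge K :
  ((unit_ball_volume R n.+1 * (mu * h / n.+1%:R / 24) ^+ n.+1)%:E <=
   hausdorff n.+1 (cell M K))%E.
Proof.
have h0 := mesh_size_gt0 K.
have r0 : 0 < mu * h / n.+1%:R / 2 by rewrite !divr_gt0 ?mulr_gt0.
have := @hausdorff_ge_cube _ _ _ (cell M K) id 1 _ (center M K) isT ltr01 r0.
rewrite mulr1 (_ : mu * h / n.+1%:R / 2 / 12 = mu * h / n.+1%:R / 24); last first.
  by field; rewrite ?pnatr_eq0.
apply; first by move=> x y _ _; rewrite mul1r.
move=> x hx; exists x => //; apply: ball_sub_cell.
set q := mu * h / n.+1%:R in r0 hx *.
apply: (@le_lt_trans _ _ (q / 2)); last by lra.
apply: norm_le_coord => [|j]; first exact: ltW.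
have := hx j; rewrite !mxE ler_norml => /andP[? ?].
by apply/andP; split; lra.
Qed.

Definition unit_area : R := unit_ball_volume R n * (n.+1%:R^-1 / 12) ^+ n.

Lemma unit_area_gt0 : 0 < unit_area.
Proof. by rewrite mulr_gt0 ?unit_ball_volume_gt0// exprn_gt0. Qed.

(** [face_area] would be [0] on a face of infinite measure. *)
Lemma face_area_fin e : H (face M e) \is a fin_num.
Proof.
have [m Om] := Omega_bound.
have [a [b [a0 [U oU fU]]]] := face_open M e.
have [K eK] := faces_cover M e.
apply: (@hausdorff_hyperplane_fin _ _ n0 _ a b m) => // [x|x ex].
  by rewrite fU => -[].
rewrite -[x]subr0; apply: (@closure_norm_le (cell M K)) => [y /cell_sub/Om|].
  by rewrite subr0.
by have [] : bdry (cell M K) x by apply: (face_sub_bdry eK); exact: subset_closure.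
Qed.

Lemma face_area_ge e : unit_area * lambda ^+ n * h ^+ n <= face_area M e.
Proof.
rewrite /face_area -lee_fin fineK ?face_area_fin//.
apply: le_trans (reg.2 e); rewrite /= -mulrA mulrC EFinM lee_wpmul2l//.
  rewrite lee_fin mulr_ge0// exprn_ge0// ?ltW//.
  by have [K _] := faces_cover M e; exact: mesh_size_gt0 K.
have r0 : 0 < n.+1%:R^-1 :> R by rewrite invr_gt0.
have := @hausdorff_ge_cube _ _ _ (eball (0 : 'rV[R]_n) 1) id 1 _ 0 n0 ltr01 r0.
rewrite mulr1; apply; first by move=> x y _ _; rewrite mul1r.
move=> x hx; exists x => //; rewrite /eball /= subr0.
apply: (le_lt_trans (enorm_le_norm _)).
apply: (@le_lt_trans _ _ (n%:R * n.+1%:R^-1)).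
  rewrite ler_wpM2l//; apply: norm_le_coord => [|j]; first by rewrite invr_ge0.
  have := hx j; rewrite mxE add0r => /andP[? ?].
  by rewrite ger0_norm.
by rewrite ltr_pdivrMr// mul1r ltr_nat.
Qed.

(** A segment from the center to a boundary point runs inside the cell, as
    the cell is star-shaped with respect to a whole ball. *)
Lemma segment_in_cell K (y : 'rV[R]_n.+1) (t : R) :
  closure (cell M K) y -> 0 <= t < 1 ->
  cell M K ((1 - t) *: center M K + t *: y).
Proof.
move=> Ky /andP[t0 t1]; set c := center M K.
have h0 := mesh_size_gt0 K.
have s0 : 0 < 1 - t by rewrite subr_gt0.
have e0 : 0 < (1 - t) * (mu * h) / n.+1%:R by rewrite divr_gt0// !mulr_gt0.
have [y' [Ky']] := Ky _ (nbhsx_ballx y _ e0); rewrite -ball_normE /= => yy'.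
pose b := c + (t / (1 - t)) *: (y - y').
have -> : (1 - t) *: c + t *: y = (1 - t) *: b + t *: y'.
  rewrite /b scalerDr scalerA mulrCA divff ?gt_eqF// mulr1 scalerBr.
  by rewrite -addrA subrK.
apply: (reg.1 K) => //; last by rewrite t0 ltW.
rewrite /eball /= /b addrC addKr (le_lt_trans (enorm_le_norm _))//.
rewrite normrZ ger0_norm ?divr_ge0 ?(ltW s0)//.
have : n.+1%:R * (t / (1 - t) * `|y - y'|) <= n.+1%:R * (1 / (1 - t) * `|y - y'|).
  by rewrite ler_pM2l// ler_wpM2r// ler_pM2r ?invr_gt0// ltW.
move=> /le_lt_trans; apply.
by rewrite mulrCA mul1r mulrC ltr_pdivrMr// mulrC -ltr_pdivlMr// [mu * h * _]mulrC.
Qed.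

Lemma pyramid_near K e (x : 'rV[R]_n.+1) : e \in faces_of M K -> pyramid M K e x ->
  `|x - center M K| <= h.
Proof.
move=> eK [t [y [/andP[t0 t1] ey ->]]].
rewrite (_ : _ - _ = t *: (y - center M K)); last first.
  by apply/rowP => j; rewrite !mxE; ring.
rewrite normrZ (gtr0_norm t0); apply: (@le_trans _ _ `|y - center M K|).
  by rewrite ler_piMl// ltW.
apply: closure_cell_near.
by have [] : bdry (cell M K) y by apply: (face_sub_bdry eK); exact: subset_closure.
Qed.

(** Otherwise the segment from the center to a point of the face, which runs in
    the cell, would stay in the hyperplane and enter the face. *)
Lemma center_off_face K e a (b : R) (U : set 'rV[R]_n.+1) : e \in faces_of M K ->
  open U -> face M e = U `&` [set x | dotp a x = b] -> dotp a (center M K) != b.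
Proof.
move=> eK oU fU; apply/eqP => cb.
have [y ey] := face_nonempty M e; set c := center M K in cb *.
have : (U `&` [set x | dotp a x = b]) y by rewrite -fU.
move=> [Uy yb].
have Ky : closure (cell M K) y.
  by have [] : bdry (cell M K) y by apply: (face_sub_bdry eK); exact: subset_closure.
have : nbhs y U by exact: open_nbhs_nbhs.
rewrite nbhs_ballP => -[r /= r0 yr].
pose s := r / (r + `|y - c|).
have q0 : 0 < r + `|y - c| by rewrite ltr_pwDl.
have s0 : 0 < s by rewrite divr_gt0.
have s1 : s <= 1 by rewrite ler_pdivrMr// mul1r lerDl.
pose p := (1 - (1 - s / 2)) *: c + (1 - s / 2) *: y.
have Kp : cell M K p by apply: segment_in_cell => //; apply/andP; split; lra.
have ep : face M e p.
  rewrite fU; split; last by rewrite /= /p dotpDr !dotpZr cb yb; ring.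
  apply: yr; rewrite -ball_normE /=.
  rewrite (_ : y - p = (s / 2) *: (y - c)); last first.
    by apply/rowP => j; rewrite !mxE; ring.
  rewrite normrZ gtr0_norm ?divr_gt0// mulrAC ltr_pdivrMr//.
  rewrite /s mulrAC ltr_pdivrMr//.
  apply: (@le_lt_trans _ _ (r * (r + `|y - c|))).
    by rewrite ler_pM2l// lerDr ltW.
  by rewrite mulrAC ltr_pMr ?mulr_gt0// ltr1n.
by apply: (bdry_cell_notin (face_sub_bdry eK (subset_closure ep))).
Qed.

Lemma dotp_continuous (a : 'rV[R]_n.+1) :
  continuous (fun z : 'rV[R]_n.+1 => dotp a z).
Proof.
have := @continuous_big R 'I_n.+1 +%R 0 xpredT (@add_continuous R^o)
  'rV[R]_n.+1 (index_enum _) (fun i z => a 0 i * z 0 i).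
apply => i _ z0.
apply: (@cvgM _ _ (nbhs z0) _ (fun=> a 0 i) (fun z => z 0 i)).
  exact: cvg_cst.
exact: coord_continuous.
Qed.

(** The parameters of a point of the pyramid depend continuously on the point,
    because the vertex is off the hyperplane of the base. *)
Lemma pyramid_interior K e : e \in faces_of M K ->
  exists z : 'rV[R]_n.+1, nbhs z (pyramid M K e).
Proof.
move=> eK; have [a [b [a0 [U oU fU]]]] := face_open M e.
have cb := center_off_face eK oU fU; set c := center M K in cb *.
have [y ey] := face_nonempty M e.
have : (U `&` [set x | dotp a x = b]) y by rewrite -fU.
move=> [Uy /= yb].
have D0 : b - dotp a c != 0 by rewrite subr_eq0 eq_sym.
(* [s z] and [g z] are the parameters of [z] in the definition of [pyramid] *)
pose s (z : 'rV[R]_n.+1) : R := (dotp a z - dotp a c) / (b - dotp a c).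
pose g (z : 'rV[R]_n.+1) : 'rV[R]_n.+1 := c + (s z)^-1 *: (z - c).
pose z0 : 'rV[R]_n.+1 := c + 2^-1 *: (y - c).
have sz0 : s z0 = 2^-1.
  by rewrite /s /z0 dotpDr dotpZr dotpBr yb; field.
have gz0 : g z0 = y.
  rewrite /g sz0 invrK (_ : z0 - c = 2^-1 *: (y - c)); last by rewrite /z0 addrC addKr.
  by rewrite scalerA divff// scale1r addrC subrK.
have cdot : dotp a z @[z --> z0] --> dotp a z0 by exact: dotp_continuous.
have cs : s z @[z --> z0] --> (2^-1 : R).
  rewrite -sz0; apply: (@cvgM _ _ (nbhs z0) _ (fun z => dotp a z - dotp a c)
    (fun=> (b - dotp a c)^-1)); last exact: cvg_cst.
  by apply: cvgB => //; exact: cvg_cst.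
have cg : g z @[z --> z0] --> y.
  rewrite -gz0.
  apply: (@cvgD _ _ _ (nbhs z0) _ (fun=> c) (fun z => (s z)^-1 *: (z - c))).
    exact: cvg_cst.
  apply: (@cvgZ _ _ _ (nbhs z0) _ (fun z => (s z)^-1) (fun z => z - c)).
    by apply: cvgV; rewrite sz0// ?invr_neq0.
  apply: (@cvgB _ _ _ (nbhs z0) _ (fun z => z) (fun=> c)); first exact: cvg_id.
  exact: cvg_cst.
have h1 : (0 : R) < 2^-1 by rewrite invr_gt0.
have h2 : (2^-1 : R) < 1 by rewrite invf_lt1// ltr1n.
have n1 := cvgr_gt _ cs _ h1; have n2 := cvgr_lt _ cs _ h2.
have n3 : \forall z \near z0, U (g z) by apply: (cg U); exact: open_nbhs_nbhs.
exists z0; near=> z.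
have sz : 0 < s z < 1.
  by apply/andP; split; near: z; [exact: n1|exact: n2].
have /andP[sp _] := sz.
exists (s z), (g z); split => //.
  rewrite fU; split.
    by near: z; exact: n3.
  rewrite /= /g dotpDr dotpZr dotpBr /s invf_div.
  have : dotp a z - dotp a c != 0.
    by apply: contraTneq sp => sz0'; rewrite /s sz0' mul0r ltxx.
  by move=> ?; field.
rewrite /g -/c scalerDr scalerA mulfV ?gt_eqF// scale1r addrA -scalerDl.
by rewrite subrK scale1r addrC subrK.
Unshelve. all: by end_near. Qed.

Definition diamond_const : R :=
  unit_ball_volume R n.+1 * (n.+1%:R * 6) ^+ n.+1.

Lemma diamond_const_gt0 : 0 < diamond_const.
Proof. by rewrite mulr_gt0 ?unit_ball_volume_gt0// exprn_gt0// mulr_gt0. Qed.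

(** Positivity matters as much as the upper bound: the volume enters the
    seminorm through its inverse. *)
Lemma diamond_volume_bounds K L e :
  e \in faces_of M K -> e \in faces_of M L ->
  0 < diamond_volume M K L e <= diamond_const * h ^+ n.+1.
Proof.
move=> eK eL; have h0 := mesh_size_gt0 K.
have [y ey] := face_nonempty M e.
have yK : `|y - center M K| <= h.
  apply: closure_cell_near.
  by have [] : bdry (cell M K) y by apply: (face_sub_bdry eK); exact: subset_closure.
have yL : `|y - center M L| <= h.
  apply: closure_cell_near.
  by have [] : bdry (cell M L) y by apply: (face_sub_bdry eL); exact: subset_closure.
have DK x : diamond M K L e x -> `|x - center M K| <= 3 * h.
  move=> /interior_subset; apply: closure_norm_le => z.
  move=> [/(pyramid_near eK)|/(pyramid_near eL)] zn.
    by rewrite (le_trans zn)//; lra.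
  rewrite (_ : z - center M K =
    (z - center M L) - (y - center M L) + (y - center M K)); last first.
    by apply/rowP => j; rewrite !mxE; ring.
  rewrite (le_trans (ler_normD _ _))// (le_trans (lerD (ler_normB _ _) (lexx _)))//.
  by lra.
have up : (hausdorff n.+1 (diamond M K L e) <= (diamond_const * h ^+ n.+1)%:E)%E.
  have := @hausdorff_le_image _ _ n.+1 (diamond M K L e) id 1 (6 * h)
    (center M K - const_mx (3 * h)) isT ler01 _ _ _.
  rewrite mulr1 mulrA exprMn mulrA; apply.
  - by rewrite mulr_gt0.
  - by move=> x z; rewrite mul1r.
  - move=> x /DK xK; exists x => // j; have := le_trans (coord_le_norm _ j) xK.
    by rewrite !mxE ler_norml => /andP[? ?]; apply/andP; split; lra.
have fin : hausdorff n.+1 (diamond M K L e) \is a fin_num.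
  by rewrite ge0_fin_numE ?hausdorff_ge0// (le_lt_trans up)// ltry.
apply/andP; split; last by rewrite -lee_fin fineK.
rewrite /diamond_volume -lte_fin fineK//.
have [z zP] := pyramid_interior eK.
have : nbhs z (diamond M K L e).
  apply: nbhs_interior; apply: filterS zP => x Px.
  by apply: subset_closure; left.
rewrite nbhs_ballP => -[r /= r0 zr].
have r20 : 0 < r / 2 by rewrite divr_gt0.
apply: lt_le_trans (@hausdorff_ge_cube _ _ n.+1 _ id 1 _ z isT ltr01 r20 _ _).
- by rewrite lte_fin mulr_gt0 ?unit_ball_volume_gt0// exprn_gt0// divr_gt0.
- by move=> x x' _ _; rewrite mul1r.
- move=> x hx; exists x => //; apply: zr; rewrite -ball_normE /=.
  apply: (@le_lt_trans _ _ (r / 2)); last by lra.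
  apply: norm_le_coord => [|j]; first exact: ltW.
  have := hx j; rewrite !mxE ler_norml => /andP[? ?].
  by apply/andP; split; lra.
Qed.

Definition seminorm_const : R :=
  2^-1 * ((unit_area * lambda ^+ n) ^+ n.+1 / diamond_const ^+ n).

Lemma seminorm_const_gt0 : 0 < seminorm_const.
Proof.
have a0 : 0 < unit_area * lambda ^+ n.
  by apply: mulr_gt0; [exact: unit_area_gt0|exact: exprn_gt0].
apply: mulr_gt0; first by rewrite invr_gt0.
by rewrite divr_gt0 ?exprn_gt0// diamond_const_gt0.
Qed.

(** Each face weight is scale invariant: [(h ^ n) ^ n.+1 / (h ^ n.+1) ^ n]. *)
Lemma seminorm1d_ge u :
  (seminorm_const * \sum_(K : T) \sum_(L : T | adj K L) `|u L - u K| ^+ n.+1)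
    `^ n.+1%:R^-1 <= seminorm1d M u.
Proof.
have ge0 (x : R) : 0 <= `|x| ^+ n.+1 by rewrite exprn_ge0.
apply: ge0_ler_powR; rewrite ?nnegrE ?invr_ge0//.
- by rewrite mulr_ge0 ?(ltW seminorm_const_gt0)// sumr_ge0// => K _; rewrite sumr_ge0.
- rewrite mulr_ge0// sumr_ge0// => K _; rewrite sumr_ge0// => L _; rewrite sumr_ge0//.
  by move=> e _; rewrite !mulr_ge0// ?invr_ge0 exprn_ge0// fine_ge0// hausdorff_ge0.
rewrite /seminorm_const -mulrA ler_pM2l// mulr_sumr; apply: ler_sum => K _.
rewrite mulr_sumr [leLHS](eq_bigl (fun L => (L != K) &&
  [exists e, (e \in faces_of M K) && (e \in faces_of M L)])); last by [].
rewrite big_mkcondr /=; apply: ler_sum => L LK.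
have term0 e : 0 <= face_area M e ^+ n.+1 * diamond_volume M K L e ^- n *
    `|u L - u K| ^+ n.+1.
  by rewrite !mulr_ge0 ?invr_ge0 ?exprn_ge0 ?fine_ge0 ?hausdorff_ge0.
case: ifPn => [/existsP[e ee]|_]; last by rewrite sumr_ge0.
rewrite (bigD1 e)//= ler_wpDr ?sumr_ge0// ler_wpM2r//.
have /andP[eK eL] := ee; have /andP[D0 D1] := diamond_volume_bounds eK eL.
have h0 := mesh_size_gt0 K.
have A0 : 0 < unit_area * lambda ^+ n * h ^+ n.
  apply: mulr_gt0; last exact: exprn_gt0.
  by apply: mulr_gt0; [exact: unit_area_gt0|exact: exprn_gt0].
apply: (@le_trans _ _ ((unit_area * lambda ^+ n * h ^+ n) ^+ n.+1 /
    (diamond_const * h ^+ n.+1) ^+ n)).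
  rewrite [X in _ <= X / _]exprMn [X in _ <= _ / X]exprMn invfM.
  rewrite -!exprM [(n.+1 * n)%N]mulnC mulrACA divff ?mulr1//.
  by rewrite expf_neq0// gt_eqF.
have B0 : 0 < diamond_const * h ^+ n.+1.
  by apply: mulr_gt0; [exact: diamond_const_gt0|exact: exprn_gt0].
have Ae := face_area_ge e.
apply: ler_pM; rewrite ?invr_ge0 ?exprn_ge0 ?(ltW A0) ?(ltW B0)//.
  by rewrite lerXn2r ?nnegrE ?(ltW A0) ?Ae// (le_trans (ltW A0)).
rewrite lef_pV2 ?posrE ?exprn_gt0//.
by rewrite lerXn2r ?nnegrE ?(ltW D0) ?(ltW B0).
Qed.

End regular.

End mesh_geometry.

(** * The uniform interior cone condition *)

Section cone.
Context {R : realType} {n : nat}.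
Local Notation d := n.+1.
Implicit Types (Omega : set 'rV[R]_d).

Lemma ex_lower_bound (I : eqType) (s : seq I) (f : I -> R) :
  (forall i, i \in s -> 0 < f i) ->
  exists2 r, 0 < r & forall i, i \in s -> r <= f i.
Proof.
elim: s => [|a s IH] fp; first by exists 1.
have [|r r0 rP] := IH; first by move=> i si; apply: fp; rewrite inE si orbT.
exists (Num.min r (f a)); first by rewrite lt_min r0 fp// mem_head.
move=> i; rewrite inE => /predU1P[->|/rP ri]; first by rewrite ge_min lexx orbT.
by rewrite ge_min ri.
Qed.

(** Cones of a common axis [e], aperture [t] and height [r], with vertex at any
    point of [Omega] near [x0]; [x0] itself may be on the boundary. *)
Definition cone_at Omega (x0 : 'rV[R]_d) (r t : R) (e : 'rV[R]_d) :=
  [/\ 0 < r, 0 < t, d%:R^-1 <= `|e| <= 1 &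
  forall x, Omega x -> `|x - x0| < r ->
  forall (s : R) w, 0 < s < r -> `|w| < t -> Omega (x + s *: (e + w))].

Lemma cone_at_interior Omega x0 : open Omega -> Omega x0 ->
  exists r t e, cone_at Omega x0 r t e.
Proof.
move=> oO Ox0; have : nbhs x0 Omega by exact: open_nbhs_nbhs.
rewrite nbhs_ballP => -[r /= r0 x0r].
exists (r / 4), 1, (const_mx 1); split => //; first by rewrite divr_gt0.
  have -> : `|const_mx 1 : 'rV[R]_d| = 1.
    apply/eqP; rewrite eq_le; apply/andP; split.
      by apply: norm_le_coord => // i; rewrite mxE normr1.
    by have := coord_le_norm (const_mx 1 : 'rV[R]_d) 0; rewrite mxE normr1.
  by rewrite lexx andbT invf_le1 ?ltr0n// ler1n.
move=> x Ox xx0 s w /andP[s0 sr] w1; apply: x0r; rewrite -ball_normE /= distrC.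
rewrite addrAC (le_lt_trans (ler_normD _ _))//.
have : `|s *: (const_mx 1 + w)| <= s * 2.
  rewrite normrZ gtr0_norm// ler_pM2l// (le_trans (ler_normD _ _))//.
  rewrite (_ : 2 = 1 + 1)//; apply: lerD; last exact: ltW.
  by apply: norm_le_coord => // i; rewrite mxE normr1.
by lra.
Qed.

(** In a chart, moving along a direction close to that of the epigraph gains
    at least as much height as the Lipschitz graph can. *)
Lemma cone_at_bdry Omega x0 : lipschitz_boundary Omega -> bdry Omega x0 ->
  exists r t e, cone_at Omega x0 r t e.
Proof.
move=> lip /lip[r [L [e [phi [r0 e1 phiL OE]]]]].
have dR : (0 : R) < d%:R by rewrite ltr0n.
have ee : dotp e e = 1.
  by rewrite -(sqr_sqrtr (dotp_ge0 e)) -/(enorm e) e1 expr1n.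
have en1 : `|e| <= 1 by rewrite -e1 norm_le_enorm.
pose A := `|L| * (d%:R * (1 + d%:R)).
have A0 : 0 <= A by rewrite !mulr_ge0// addr_ge0.
(* [t] is so small that the height gained by [e + w], at least [1 - d t], exceeds
   the variation of the graph, at most [A t] *)
pose t : R := (1 + d%:R + A)^-1.
have tp : 0 < 1 + d%:R + A by rewrite ltr_wpDr// addr_gt0.
have t0 : 0 < t by rewrite invr_gt0.
have tA : (d%:R + A) * t <= 1.
  by rewrite ler_pdivrMr// mul1r; lra.
have t1 : t <= 1 by rewrite invf_le1//; lra.
exists (r / (3 * d%:R + 1)), t, e; split => //.
- by rewrite divr_gt0// addr_gt0// mulr_gt0.
- have := enorm_le_norm e; rewrite e1 => h.
  by rewrite en1 andbT -[leLHS]mul1r ler_pdivrMr// mulrC.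
move=> x Ox xx0 s w /andP[s0 sr] wt.
set r1 := r / _ in xx0 sr.
have r1r : d%:R * (r1 + r1 * 2) < r.
  have : r1 * (3 * d%:R + 1) = r.
    by rewrite /r1 divfK// gt_eqF// addr_gt0// mulr_gt0.
  have : 0 < r1 by rewrite (lt_trans s0).
  by move=> h <-; nra.
have ew : `|e + w| <= 2.
  by rewrite (le_trans (ler_normD _ _))// (_ : 2 = 1 + 1)// lerD// (le_trans (ltW wt)).
have x0r : eball x0 r x.
  rewrite /eball /= (le_lt_trans (enorm_le_norm _))//.
  apply: le_lt_trans r1r; rewrite ler_wpM2l// (le_trans (ltW xx0))// lerDl.
  by rewrite mulr_ge0// ltW// (lt_trans s0).
have x'r : eball x0 r (x + s *: (e + w)).
  rewrite /eball /= (le_lt_trans (enorm_le_norm _))//.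
  apply: le_lt_trans r1r; rewrite ler_wpM2l// addrAC (le_trans (ler_normD _ _))//.
  rewrite lerD ?(ltW xx0)// normrZ gtr0_norm//.
  by rewrite ler_pM// ltW.
have : (Omega `&` eball x0 r) x by [].
rewrite OE => -[/= px _].
suff : (Omega `&` eball x0 r) (x + s *: (e + w)) by case.
rewrite OE; split => //=.
set x' := x + _.
pose tan (z : 'rV[R]_d) : 'rV[R]_d := z - dotp z e *: e.
have tane z : dotp (tan z) e = 0.
  by rewrite dotpC /tan dotpBr dotpZr ee mulr1 [dotp e z]dotpC subrr.
have we : `|dotp w e| <= d%:R * t.
  rewrite dotpC (le_trans (dotp_le _ _))// ler_pM// ?sumr_ge0// ?(ltW wt)//.
  apply: (@le_trans _ _ (\sum_(i < d) 1)); last by rewrite sumr_const card_ord.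
  by apply: ler_sum => i _; rewrite (le_trans (coord_le_norm _ _)).
have tanE : tan x' - tan x = s *: tan w.
  have -> : tan x' - tan x = (x' - x) - (dotp x' e - dotp x e) *: e.
    by rewrite /tan scalerBl; apply/rowP => i; rewrite !mxE; ring.
  have -> : x' - x = s *: (e + w) by rewrite /x' addrC addKr.
  have -> : dotp x' e - dotp x e = s * (1 + dotp w e).
    by rewrite /x' ![dotp _ e]dotpC !(dotpDr,dotpZr) ee; ring.
  by rewrite /tan; apply/rowP => i; rewrite !mxE; ring.
have tw : enorm (tan x' - tan x) <= s * (d%:R * (1 + d%:R) * t).
  rewrite (le_trans (enorm_le_norm _))// tanE normrZ gtr0_norm//.
  rewrite mulrCA ler_pM2l// -mulrA ler_wpM2l// mulrDl mul1r.
  rewrite (le_trans (ler_normB _ _))// lerD ?(ltW wt)// normrZ.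
  by rewrite (le_trans _ we)// ler_piMr.
have := phiL (tan x') (tan x) (tane _) (tane _).
rewrite ler_norml => /andP[_ h].
have h2 : L * enorm (tan x' - tan x) <= s * (A * t).
  apply: (@le_trans _ _ (`|L| * enorm (tan x' - tan x))).
    by rewrite ler_wpM2r ?ler_norm// sqrtr_ge0.
  apply: (le_trans (ler_wpM2l (normr_ge0 _) tw)).
  by rewrite le_eqVlt /A; apply/orP; left; apply/eqP; ring.
have x'e : dotp x' e = dotp x e + s * (1 + dotp w e).
  by rewrite /x' ![dotp _ e]dotpC !(dotpDr,dotpZr) ee; ring.
rewrite -/(tan x') x'e.
have wge : - (d%:R * t) <= dotp w e.
  by have := we; rewrite ler_norml => /andP[].
have : s * (A * t) <= s * (1 + dotp w e).
  by rewrite ler_pM2l//; move: tA; rewrite mulrDl; lra.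
rewrite -/(tan x) in px; rewrite /= in h; move: h h2 px; lra.
Qed.

(** The local cones are made uniform by compactness of the closure. *)
Lemma cone_condition Omega : bounded_set Omega -> open Omega ->
  lipschitz_boundary Omega ->
  exists rho theta : R, [/\ 0 < rho, 0 < theta &
    forall x, Omega x -> exists e : 'rV[R]_d, d%:R^-1 <= `|e| <= 1 /\
      forall (s : R) w, 0 < s < rho -> `|w| < theta -> Omega (x + s *: (e + w))].
Proof.
move=> bO oO lip.
have loc x0 : exists p : R * R * 'rV[R]_d,
    closure Omega x0 -> cone_at Omega x0 p.1.1 p.1.2 p.2.
  have [Ox0|nOx0] := pselect (closure Omega x0); last first.
    by exists (1, 1, 0) => /nOx0.
  have : exists r t e, cone_at Omega x0 r t e.
    have [h|h] := pselect (Omega x0); first exact: cone_at_interior.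
    by apply: cone_at_bdry => //; split => // /interior_subset.
  by move=> [r [t [e h]]]; exists (r, t, e).
have [p pP] := choice loc.
have cO : compact (closure Omega).
  apply: bounded_closed_compact; last exact: closed_closure.
  have [m [_ hm]] := bO; exists (m + 1); split; first exact: num_real.
  move=> M mM x Ox /=.
  apply/ler_addgt0Pr => eps e0.
  have [y [Oy]] := Ox _ (nbhsx_ballx x eps e0); rewrite -ball_normE /= => xy.
  have mM' : m < M by apply: lt_trans mM; rewrite ltrDl.
  rewrite -(subrK y x) addrC (le_trans (ler_normD _ _))// lerD ?(ltW xy)//.
  exact: (hm _ mM').
have : closure Omega `<=` cover (closure Omega) (fun x0 => ball x0 (p x0).1.1).
  by move=> x Ox; exists x => //; apply: ballxx; case: (pP x Ox).
move: cO; rewrite compact_cover => cO /cO[].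
  by move=> x0 Ox0; apply: ball_open; case: (pP x0 Ox0).
move=> D DO DP.
have DOm x0 : x0 \in D -> closure Omega x0 by move=> /DO; rewrite inE.
have [r r0 rP] := @ex_lower_bound _ (enum_fset D) (fun x0 => (p x0).1.1)
  (fun x0 x0D => let: And4 h _ _ _ := pP x0 (DOm x0 x0D) in h).
have [t t0 tP] := @ex_lower_bound _ (enum_fset D) (fun x0 => (p x0).1.2)
  (fun x0 x0D => let: And4 _ h _ _ := pP x0 (DOm x0 x0D) in h).
exists r, t; split => // x Ox.
have [x0 /= x0D] := DP _ (subset_closure Ox); rewrite -ball_normE /= distrC => xx0.
have [_ _ en cone] := pP x0 (DOm x0 x0D).
exists (p x0).2; split => // s w /andP[s0 sr] wt; apply: cone => //.
  by rewrite s0 (lt_le_trans sr)// rP.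
by rewrite (lt_le_trans wt)// tP.
Qed.

End cone.

(** * Finite sums and chains *)

Section finite_sums.
Context {R : realType}.

Lemma hoelder_fsum (I : finType) (a b : I -> R) (p q : R) :
  (forall i, 0 <= a i) -> (forall i, 0 <= b i) ->
  0 < p -> 0 < q -> p^-1 + q^-1 = 1 ->
  \sum_i a i * b i <=
  (\sum_i a i `^ p) `^ p^-1 * (\sum_i b i `^ q) `^ q^-1.
Proof.
move=> a0 b0 p0 q0 pq; set A := \sum_i a i `^ p; set B := \sum_i b i `^ q.
have zero (f : I -> R) (s : R) : 0 < s -> (forall i, 0 <= f i) ->
    \sum_i f i `^ s = 0 -> forall i, f i = 0.
  move=> s0 f0 /eqP; rewrite psumr_eq0 => [/allP H i|i _]; last exact: powR_ge0.
  by have := H i (mem_index_enum i); rewrite /= => /eqP/powR_eq0_eq0.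
have [A0|A0] := eqVneq A 0.
  rewrite big1 ?mulr_ge0 ?powR_ge0// => i _.
  by rewrite (zero a p p0 a0 A0) mul0r.
have [B0|B0] := eqVneq B 0.
  rewrite big1 ?mulr_ge0 ?powR_ge0// => i _.
  by rewrite (zero b q q0 b0 B0) mulr0.
have Ap : 0 < A by rewrite lt_neqAle eq_sym A0 sumr_ge0// => i _; exact: powR_ge0.
have Bp : 0 < B by rewrite lt_neqAle eq_sym B0 sumr_ge0// => i _; exact: powR_ge0.
have norm (r X : R) : 0 < r -> 0 < X ->
    exists2 X', X `^ r^-1 = X' & 0 < X' /\ X' `^ r = X.
  move=> r0 X0; exists (X `^ r^-1) => //; split; first exact: powR_gt0.
  by rewrite -powRrM mulVf ?gt_eqF// powRr1 ?ltW.
have inv (x r : R) : 0 < x -> x^-1 `^ r = (x `^ r)^-1.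
  by move=> x0; rewrite -(powR_inv1 (ltW x0)) -powRrM mulN1r powRN.
have [A' -> [A'0 A'p]] := norm p A p0 Ap.
have [B' -> [B'0 B'q]] := norm q B q0 Bp.
suff h : \sum_i (a i / A') * (b i / B') <= 1.
  have -> : \sum_i a i * b i = A' * B' * \sum_i (a i / A') * (b i / B').
    rewrite mulr_sumr; apply: eq_bigr => i _.
    by field; rewrite !gt_eqF.
  by rewrite ler_piMr// mulr_ge0 ?ltW.
apply: (@le_trans _ _ (\sum_i (a i `^ p / A / p + b i `^ q / B / q))).
  apply: ler_sum => i _.
  have := @conjugate_powR R (a i / A') (b i / B') p q.
  rewrite !divr_ge0 ?(ltW A'0) ?(ltW B'0)// => /(_ isT isT p0 q0 pq).
  rewrite !powRM ?invr_ge0 ?(ltW A'0) ?(ltW B'0)//.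
  by rewrite !inv// A'p B'q.
rewrite big_split /= -!mulr_suml -/A -/B !divff// !mul1r.
by rewrite pq.
Qed.

Lemma harmonic_le (N : nat) : (0 < N)%N ->
  \sum_(t < N) (t%:R : R)^-1 <= 1 + ln N%:R.
Proof.
move=> N0; apply: (@le_trans _ _ (\sum_(t < N.+1) (t%:R : R)^-1)).
  by rewrite big_ord_recr /= lerDl invr_ge0.
case: N N0 => // N _; elim: N => [|N IH].
  by rewrite 2!big_ord_recr big_ord0 /= invr0 !add0r ln1 addr0 invr1.
rewrite big_ord_recr /= (le_trans (lerD IH (lexx _)))// -addrA lerD2l.
have N1 : (0 : R) < N.+1%:R by [].
have N2 : (0 : R) < N.+2%:R by [].
have x1 : -1 < - N.+2%:R^-1 :> R by rewrite ltrN2 invf_lt1// ltr1n.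
have := le_ln1Dx x1.
have -> : 1 - N.+2%:R^-1 = N.+1%:R / N.+2%:R :> R.
  by rewrite -[N.+1%:R](addrK 1) natr1 mulrBl mul1r divff// gt_eqF.
by rewrite ln_div ?posrE//; move: (ln N.+1%:R) (ln N.+2%:R) (N.+2%:R^-1 : R) => *; lra.
Qed.

(** Weighted counting form of the estimate of a Riesz potential. Each [i] of
    [I] carries the weight [W i] of the [s] near it, which decays like
    [(tau s) ^- n] for each of them; Hoelder's inequality then costs
    [\sum_i W i `^ (n.+1 / n)], where one factor [W i `^ (1 / n)] is bounded by
    [(tau s)^-1] for each [s] counted by the other factor. *)
Lemma sum_near_le (n : nat) (I S : finType) (near : S -> pred I) (tau : S -> R)
    (du : I -> R) (C N0 Z : R) :
  (0 < n)%N -> 0 <= C -> 0 <= N0 -> 0 < Z -> (forall i, 0 <= du i) ->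
  (forall s, 0 <= tau s) -> (forall s, #|near s|%:R <= N0) ->
  (forall s i, near s i ->
    \sum_(s' | near s' i) 1 <= Z * (C * (tau s)^-1 ^+ n)) ->
  \sum_s \sum_(i | near s i) du i <=
  Z * ((N0 * C `^ n%:R^-1 * (Z^-1 * \sum_s (tau s)^-1)) `^ (n%:R / n.+1%:R) *
       (\sum_i du i ^+ n.+1) `^ n.+1%:R^-1).
Proof.
move=> n0 C0 N00 Z0 du0 tau0 cardn Wle.
have nR : (0 : R) < n%:R by rewrite ltr0n.
have n1R : (0 : R) < n.+1%:R by rewrite ltr0n.
pose W i : R := \sum_(s | near s i) 1.
pose w i := W i / Z.
have W0 i : 0 <= W i by exact: sumr_ge0.
have w0 i : 0 <= w i by rewrite divr_ge0// ltW.
have -> : \sum_s \sum_(i | near s i) du i = Z * \sum_i w i * du i.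
  under eq_bigr do rewrite big_mkcond.
  rewrite exchange_big mulr_sumr /=; apply: eq_bigr => i _.
  rewrite -big_mkcond /= mulrA (_ : Z * w i = W i); last by rewrite mulrC divfK ?gt_eqF.
  by rewrite mulr_suml; apply: eq_bigr => s _; rewrite mul1r.
rewrite ler_pM2l//.
pose p : R := n.+1%:R / n%:R.
have p0 : 0 < p by rewrite divr_gt0.
have pq : p^-1 + n.+1%:R^-1 = 1.
  by rewrite /p invf_div -[X in _ + X]mul1r -mulrDl natr1 divff// gt_eqF.
apply: (le_trans (hoelder_fsum w0 du0 p0 n1R pq)).
rewrite /p invf_div; apply: ler_pM; rewrite ?powR_ge0//; last first.
  rewrite le_eqVlt; apply/orP; left; apply/eqP; congr (_ `^ _).
  by apply: eq_bigr => i _; rewrite powR_mulrn.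
have tn s : 0 <= (tau s)^-1 by rewrite invr_ge0.
apply: ge0_ler_powR; rewrite ?nnegrE ?divr_ge0//.
- by rewrite sumr_ge0// => i _; exact: powR_ge0.
- by rewrite !mulr_ge0 ?powR_ge0 ?invr_ge0 ?(ltW Z0) ?sumr_ge0.
have wp i : w i `^ p = Z^-1 * \sum_(s | near s i) w i `^ n%:R^-1.
  rewrite (_ : p = 1 + n%:R^-1); last first.
    by rewrite /p -natr1 mulrDl divff ?gt_eqF// mul1r.
  rewrite powRD; last by rewrite gt_eqF ?ltr_wpDr// ?invr_ge0.
  rewrite powRr1// {1}/w /W mulrAC mulrC; congr (_ * _).
  by rewrite mulr_suml; apply: eq_bigr => s _; rewrite mul1r.
under eq_bigr do rewrite wp.
rewrite -mulr_sumr mulrCA ler_pM2l ?invr_gt0//.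
under eq_bigr do rewrite big_mkcond.
rewrite exchange_big /= mulr_sumr; apply: ler_sum => s _; rewrite -big_mkcond /=.
apply: (@le_trans _ _ (\sum_(i | near s i) C `^ n%:R^-1 * (tau s)^-1)).
  apply: ler_sum => i si.
  have -> : (tau s)^-1 = ((tau s)^-1 ^+ n) `^ n%:R^-1.
    by rewrite -powR_mulrn// -powRrM divff ?gt_eqF// powRr1.
  rewrite -powRM ?exprn_ge0//; apply: ge0_ler_powR; rewrite ?nnegrE ?invr_ge0//.
    by rewrite mulr_ge0// exprn_ge0.
  by rewrite /w ler_pdivrMr// mulrC; exact: Wle.
rewrite sumr_const -[leLHS]mulr_natl -mulrA ler_wpM2r//.
by rewrite mulr_ge0// powR_ge0.
Qed.

(** Along a chain without repetition there are at most as many steps as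
    vertices. *)
Lemma connect_le (T : finType) (r : rel T) (Q : pred T) (u : T -> R) (S : R) K L :
  0 <= S -> (forall A B, r A B -> Q B) -> (forall A B, r A B -> `|u B - u A| <= S) ->
  connect r K L -> `|u L - u K| <= #|Q|%:R * S.
Proof.
move=> S0 rQ rS /connectP[p0 p0P ->]; case/shortenP: p0P => p pP /= /andP[_ pu] _.
have step : `|u (last K p) - u K| <= (size p)%:R * S.
  elim: p K pP pu => [|a p IH] K /=; first by rewrite subrr normr0 mul0r.
  move=> /andP[Ka pa] /andP[_ pu].
  rewrite -natr1 mulrDl mul1r (_ : _ - _ = (u (last a p) - u a) + (u a - u K)).
    by rewrite (le_trans (ler_normD _ _))// lerD ?IH ?rS.
  by rewrite addrA subrK.
apply: (le_trans step); rewrite ler_wpM2r// ler_nat.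
rewrite -(card_uniqP pu); apply: subset_leq_card; apply/fintype.subsetP => B.
move: {step pu} pP; elim: p K => [//|a p IH] K /= /andP[Ka pa].
by rewrite inE => /predU1P[->|/(IH _ pa)//]; exact: rQ Ka.
Qed.

End finite_sums.

(** * Paths in a cone *)

Section paths.
Context {R : realType} {n : nat} {Omega : set 'rV[R]_n.+1} {T E : finType}.
Variable M : mesh Omega T E.
Hypothesis n0 : (0 < n)%N.
Hypothesis bO : bounded_set Omega.
Local Notation d := n.+1.
Local Notation h := (mesh_size M).
Local Notation center := Defs.center.
Variables mu lambda rho theta : R.
Hypothesis reg : regular_mesh M mu lambda.
Hypotheses (mu0 : 0 < mu) (mu1 : mu <= 1 / 2).
Hypotheses (theta0 : 0 < theta) (thetad : theta <= d%:R^-1).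
Variables (K0 : T) (e : 'rV[R]_d).
Hypothesis e_bounds : d%:R^-1 <= `|e| <= 1.
Hypothesis cone : forall (s : R) w, 0 < s < rho -> `|w| < theta ->
  Omega (center M K0 + s *: (e + w)).
Variables t0 N : nat.
Hypotheses (t00 : (0 < t0)%N) (t0theta : 6 / theta <= t0%:R) (t0N : (t0 <= N)%N).

(* The steps are so short that the first [t0] of them stay in the ball inscribed
   in [K0], and from then on the cone is wide enough to contain a ball around
   each step. *)
Let step : R := mu / d%:R / (4 * t0%:R).
Let delta : R := step * h.
Hypothesis Nrho : N%:R * delta < rho.

(* The [e + w k] form a grid in a cube of admissible directions. *)
Let dir := {ffun 'I_d -> 'I_N}.
Let w (k : dir) : 'rV[R]_d := \row_i (theta / 2 / N%:R * (k i)%:R).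
Let p (t : nat) (k : dir) : 'rV[R]_d :=
  center M K0 + (t%:R * delta) *: (e + w k).

Let h0 : 0 < h. Proof. exact: mesh_size_gt0 K0. Qed.
Let dR : (0 : R) < d%:R. Proof. by rewrite ltr0n. Qed.
Let tR : (0 : R) < t0%:R. Proof. by rewrite ltr0n. Qed.
Let N_gt0 : (0 < N)%N. Proof. exact: leq_trans t0N. Qed.
Let NR : (0 : R) < N%:R. Proof. by rewrite ltr0n. Qed.
Let step0 : 0 < step. Proof. by rewrite !divr_gt0// mulr_gt0. Qed.
Let delta0 : 0 < delta. Proof. exact: mulr_gt0. Qed.

Let step_le : step <= 1 / 8.
Proof.
rewrite /step ler_pdivrMr ?mulr_gt0// ler_pdivrMr//.
have : (1 : R) <= t0%:R by rewrite ler1n.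
have : (1 : R) <= d%:R by rewrite ler1n.
move=> d1 t1; have := ler_pM ler01 ler01 t1 d1; rewrite mulr1 => td.
rewrite [leRHS](_ : _ = t0%:R * d%:R / 2); last by field.
by move: (t0%:R * d%:R) td => q; move: mu1; lra.
Qed.

Let w_le k : `|w k| <= theta / 2.
Proof.
apply: norm_le_coord => [|i]; first by rewrite divr_ge0// ltW.
rewrite mxE ger0_norm; last by rewrite mulr_ge0// !divr_ge0// ltW.
rewrite -mulrA ler_piMr//; first by rewrite divr_ge0// ltW.
by rewrite mulrC ler_pdivrMr// mul1r ler_nat ltnW.
Qed.

Let theta1 : theta <= 1.
Proof. by rewrite (le_trans thetad)// invf_le1// ler1n. Qed.

Let dir_le k : `|e + w k| <= 2.
Proof.
have /andP[_ e1] := e_bounds; rewrite (le_trans (ler_normD _ _))//.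
by have := w_le k; move: theta1 e1; lra.
Qed.

Let dir_ge k : (2 * d%:R)^-1 <= `|e + w k|.
Proof.
have /andP[e1 _] := e_bounds.
have : `|e| <= `|e + w k| + `|w k|.
  by rewrite -{1}(addrK (w k) e) ler_normB.
have -> : (2 * d%:R)^-1 = d%:R^-1 / 2 :> R by field; rewrite gt_eqF.
by move: (w_le k) thetad e1; move: (d%:R^-1 : R) => di; lra.
Qed.

Let path_dist t k : `|p t k - center M K0| = t%:R * delta * `|e + w k|.
Proof.
by rewrite /p addrC addKr normrZ ger0_norm// mulr_ge0// ltW.
Qed.

Let path_in t k : (t0 <= t <= N)%N -> ball (p t k) (3 * delta) `<=` Omega.
Proof.
move=> /andP[t0t tN] z; rewrite -ball_normE /= => zp.
have tp : (0 : R) < t%:R by rewrite ltr0n (leq_trans t00).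
have td : 0 < t%:R * delta by rewrite mulr_gt0.
pose w' : 'rV[R]_d := w k - (t%:R * delta)^-1 *: (p t k - z).
have -> : z = center M K0 + (t%:R * delta) *: (e + w').
  rewrite /w' addrA scalerBr scalerA divff ?gt_eqF// scale1r.
  by rewrite addrA -/(p t k) opprB addrC subrK.
apply: cone.
  rewrite td (le_lt_trans _ Nrho)// ler_pM2r// ler_nat//.
rewrite /w' (le_lt_trans (ler_normB _ _))//.
have : `|(t%:R * delta)^-1 *: (p t k - z)| < theta / 2.
  rewrite normrZ gtr0_norm ?invr_gt0// mulrC ltr_pdivrMr//.
  apply: (lt_le_trans zp); rewrite [leRHS]mulrA ler_pM2r//.
  have : 6 / theta <= t%:R by rewrite (le_trans t0theta)// ler_nat.
  by rewrite ler_pdivrMr// => ?; lra.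
by have := w_le k; lra.
Qed.

Let path_step t k : `|p t k - p t.+1 k| < 3 * delta.
Proof.
have -> : p t k - p t.+1 k = - (delta *: (e + w k)).
  by rewrite /p -natr1; apply/rowP => i; rewrite !mxE; ring.
rewrite normrN normrZ gtr0_norm// mulrC ltr_pM2r//.
by rewrite (le_lt_trans (dir_le k))// ltr_nat.
Qed.

Let path_start k : cell M K0 (p t0 k).
Proof.
apply: (ball_sub_cell reg); rewrite path_dist.
apply: (@le_lt_trans _ _ (t0%:R * delta * 2)).
  by rewrite ler_pM2l; [exact: dir_le|exact: mulr_gt0].
rewrite /delta /step (_ : _ * 2 = mu * h / d%:R / 2); last first.
  by field; rewrite !gt_eqF.
by rewrite ltr_pdivrMr// ltr_pMr ?ltr1n// divr_gt0// mulr_gt0.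
Qed.

(* At time [t] the points of the paths form a grid of spacing
   [t * delta * (theta / 2) / N], coarser as [t] grows, which bounds the number
   of directions leading near a given point. *)
Let Cdir : R := 8 / (step * theta) + 1.

Let Cdir0 : 0 < Cdir.
Proof. by rewrite addr_gt0// divr_gt0// mulr_gt0. Qed.

Let path_count t (c : 'rV[R]_d) : (0 < t <= N)%N ->
  #|[set k | `|p t k - c| <= 2 * h]%SET|%:R <= (Cdir * (N%:R / t%:R)) ^+ d.
Proof.
move=> /andP[tp tN]; have tpR : (0 : R) < t%:R by rewrite ltr0n.
pose a : R := t%:R * delta * (theta / 2 / N%:R).
have a0 : 0 < a.
  by apply: mulr_gt0; [exact: mulr_gt0|rewrite !divr_gt0].
have h20 : 0 <= 2 * h by rewrite mulr_ge0// ltW.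
pose b (i : 'I_d) := (c - center M K0 - (t%:R * delta) *: e) 0 i.
apply: (@le_trans _ _ ((2 * (2 * h) / a + 1) ^+ d)).
  apply: le_trans (card_ffun_box N b a0 h20); rewrite ler_nat.
  apply: subset_leq_card; apply/fintype.subsetP => k; rewrite inE => kc.
  rewrite inE; apply/forallP => i; apply: le_trans kc.
  apply: le_trans (coord_le_norm _ i); rewrite /b /p /a !mxE le_eqVlt.
  by apply/orP; left; apply/eqP; congr (`|_|); ring.
have q1 : 1 <= N%:R / t%:R :> R by rewrite ler_pdivlMr// mul1r ler_nat.
rewrite lerXn2r ?nnegrE//.
- by rewrite addr_ge0// divr_ge0 ?mulr_ge0 ?(ltW a0)// ltW.
- by rewrite mulr_ge0 ?(ltW Cdir0)// (le_trans ler01).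
rewrite /Cdir [leRHS]mulrDl mul1r lerD// le_eqVlt; apply/orP; left; apply/eqP.
by rewrite /a /delta; field; rewrite !gt_eqF.
Qed.

Let Ctime : R := 4 * d%:R + 8 * d%:R / step.

Let Ctime1 : 1 <= Ctime.
Proof.
have : (1 : R) <= d%:R by rewrite ler1n.
have : 0 <= 8 * d%:R / step by rewrite divr_ge0 ?(ltW step0)// mulr_ge0.
by rewrite /Ctime; lra.
Qed.

(** The distance to the vertex determines the time up to a bounded factor. *)
Let path_ratio t t' k k' c : (0 < t)%N ->
  `|c - p t k| <= 2 * h -> `|c - p t' k'| <= 2 * h -> t'%:R <= Ctime * t%:R.
Proof.
move=> tp ct ct'.
have h1 : `|p t' k' - center M K0| <= 4 * h + `|p t k - center M K0|.
  have -> : p t' k' - center M K0 =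
      (c - p t k) - (c - p t' k') + (p t k - center M K0).
    by apply/rowP => i; rewrite !mxE; ring.
  by rewrite (le_trans (ler_normD _ _))// lerD2r (le_trans (ler_normB _ _))//; lra.
rewrite !path_dist in h1.
have t1 : (1 : R) <= t%:R by rewrite ler1n.
have h2 : t'%:R * delta * (2 * d%:R)^-1 <= 4 * h + t%:R * delta * 2.
  apply: le_trans (le_trans h1 _).
    by rewrite ler_wpM2l// mulr_ge0// ltW.
  by rewrite lerD2l ler_wpM2l// mulr_ge0// ltW.
have h3 : t'%:R <= (4 * h + t%:R * delta * 2) * (2 * d%:R) / delta.
  by rewrite ler_pdivlMr// -ler_pdivrMr// mulr_gt0.
apply: (le_trans h3).
have -> : (4 * h + t%:R * delta * 2) * (2 * d%:R) / delta =
    4 * d%:R * t%:R + 8 * d%:R / step.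
  by rewrite /delta; field; rewrite !gt_eqF.
rewrite /Ctime [leRHS]mulrDl lerD2l ler_peMr// divr_ge0 ?(ltW step0)// mulr_ge0//.
Qed.

(* The pairs of neighbours that may be crossed at time [s.1] in direction [s.2]. *)
Let near (s : 'I_N * dir) : pred (T * T) := fun i =>
  [&& (t0 <= s.1)%N, adj M i.1 i.2, `|center M i.1 - p s.1 s.2| <= 2 * h &
      `|center M i.2 - p s.1 s.2| <= 2 * h].

Let Cweight : R := 3 * Ctime * (Cdir * Ctime) ^+ d.

Let Cweight0 : 0 <= Cweight.
Proof.
have Ctime0 : 0 <= Ctime by exact: le_trans Ctime1.
by rewrite !mulr_ge0// exprn_ge0// mulr_ge0// ltW.
Qed.

(** The times at which a pair is near the paths are comparable with each other
    by [path_ratio], so for [t = s.1] there are at most of order [t] of them,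
    each with at most [(Cdir * Ctime * (N / t)) ^+ d] directions. *)
Let weight_le s i : near s i ->
  \sum_(s' | near s' i) 1 <= N%:R ^+ d * (Cweight * (s.1%:R)^-1 ^+ n).
Proof.
case: s => t k /and4P[/= t0t _ ct _].
have tp : (0 < t)%N by rewrite (leq_trans t00).
have tpR : (0 : R) < t%:R by rewrite ltr0n.
have Ctime0 : 0 < Ctime by exact: lt_le_trans Ctime1.
pose B : R := (Cdir * Ctime * (N%:R / t%:R)) ^+ d.
have B0 : 0 <= B.
  by rewrite exprn_ge0// mulr_ge0 ?divr_ge0 ?(ltW tpR)// mulr_ge0// ltW.
pose tm := [set t' : 'I_N | `|1 * t'%:R - 0| <= Ctime * t%:R]%SET.
apply: (@le_trans _ _ (\sum_(t' in tm) B)).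
  rewrite big_mkcond -(pair_bigA _ (fun t' k' => if near (t', k') i then 1 else 0)) /=.
  rewrite [leRHS]big_mkcond /=; apply: ler_sum => t' _.
  rewrite -big_mkcond /=.
  have [t0t'|t0t'] := leqP t0 t'; last first.
    rewrite big_pred0 => [|k']; last by rewrite /near /= leqNgt t0t'.
    by case: ifP.
  have tp' : (0 < t')%N by rewrite (leq_trans t00).
  have tpR' : (0 : R) < t'%:R by rewrite ltr0n.
  have [e0|[k1]] := set_0Vmem [set k' | near (t', k') i]%SET.
    rewrite big_pred0 => [|k']; first by case: ifP.
    apply/negP => kn; have kk : k' \in [set k' | near (t', k') i]%SET by rewrite inE.
    by move: kk; rewrite e0 finset.in_set0.
  rewrite inE => /and4P[/= _ _ ct1 _].
  rewrite ifT; last first.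
    rewrite inE mul1r subr0 ger0_norm//.
    exact: (path_ratio tp ct ct1).
  rewrite sumr_const.
  have [t1N t2N] : (0 < t')%N /\ (t' <= N)%N by split => //; exact: ltnW.
  apply: (@le_trans _ _ (#|[set k | `|p t' k - center M i.1| <= 2 * h]%SET|%:R)).
    rewrite ler_nat subset_leq_card//; apply/fintype.subsetP => k' /and4P[_ _ h1 _].
    by rewrite inE distrC.
  apply: (le_trans (path_count _ _)); first by rewrite t1N.
  have q0 (r : R) : 0 < r -> 0 <= Cdir * (N%:R / r).
    by move=> r0; rewrite mulr_ge0 ?(ltW Cdir0)// divr_ge0// ltW.
  rewrite /B lerXn2r ?nnegrE ?q0//.
    by rewrite mulr_ge0 ?divr_ge0 ?(ltW tpR)// mulr_ge0// ltW.
  rewrite -[leRHS]mulrA ler_pM2l// mulrCA ler_pM2l//.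
  have := path_ratio tp' ct1 ct => h1.
  by rewrite ler_pdivlMr// mulrC ler_pdivrMr// mulrC.
rewrite sumr_const.
have tmle : #|tm|%:R <= 3 * Ctime * t%:R.
  have mt0 : 0 <= Ctime * t%:R by rewrite mulr_ge0// ltW.
  apply: (le_trans (card_ord_interval N 0 ltr01 mt0)).
  have : (1 : R) <= t%:R by rewrite ler1n.
  have := ler_pM ler01 ler01 Ctime1 (_ : 1 <= t%:R :> R).
  by move=> H t1; have := H t1; rewrite divr1 mulr1 -mulrA; lra.
rewrite -[leLHS]mulr_natl; apply: (le_trans (ler_wpM2r B0 tmle)).
rewrite /B /Cweight le_eqVlt; apply/orP; left; apply/eqP.
rewrite [(Cdir * Ctime * _) ^+ _]exprMn expr_div_n exprVn [t%:R ^+ d]exprS.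
by field; rewrite expf_neq0// gt_eqF.
Qed.

Let Nnear : R := (4 * d%:R / mu + 1) ^+ d.

Let Nnear0 : 0 <= Nnear.
Proof.
by rewrite exprn_ge0// addr_ge0// divr_ge0 ?(ltW mu0)// mulr_ge0.
Qed.

Let card_close q : #|[set A | `|center M A - q| <= 2 * h]%SET|%:R <= Nnear.
Proof.
have s0 : 0 < mu * h / d%:R by rewrite divr_gt0// mulr_gt0.
have h20 : 0 <= 2 * h by rewrite mulr_ge0// ltW.
rewrite /Nnear (_ : 4 * d%:R / mu = 2 * (2 * h) / (mu * h / d%:R)); last first.
  by field; rewrite !gt_eqF.
apply: (@card_separated _ _ _ _ (center M) q) => //.
- by move=> A B _ _; exact: (centers_separated n0 reg).
- by move=> A; rewrite inE.
Qed.

Let card_near s : #|near s|%:R <= Nnear ^+ 2.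
Proof.
set Q := [set A | `|center M A - p s.1 s.2| <= 2 * h]%SET.
apply: (@le_trans _ _ (#|Q| * #|Q|)%:R).
  rewrite ler_nat -cardsX subset_leq_card//; apply/fintype.subsetP => i.
  by move=> /and4P[_ _ h1 h2]; rewrite !inE h1 h2.
by rewrite natrM expr2 ler_pM// card_close.
Qed.

Let du (u : T -> R) (i : T * T) : R := if adj M i.1 i.2 then `|u i.2 - u i.1| else 0.

Let du0 u i : 0 <= du u i.
Proof. by rewrite /du; case: ifP. Qed.

(** The cells touching a ball around the step are connected by pairs of
    neighbours, all of them near the step. *)
Let jump u (t : 'I_N) k A B : (t0 <= t)%N ->
  closure (cell M A) (p t k) -> closure (cell M B) (p t.+1 k) ->
  `|u B - u A| <= Nnear * \sum_(i | near (t, k) i) du u i.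
Proof.
move=> t0t At Bt; set q := p t k.
pose U := ball q (3 * delta).
have d30 : 0 < 3 * delta by exact: mulr_gt0.
have oU : open U by exact: ball_open.
have UA : touches M U A by apply: closure_touches At _ => //; exact: ballxx.
have UB : touches M U B.
  by apply: closure_touches Bt _ => //; rewrite /U -ball_normE /=; exact: path_step.
have cU x y (s : R) : U x -> U y -> 0 <= s <= 1 -> U (x + s *: (y - x)).
  rewrite /U -ball_normE /= => xq yq /andP[s0 s1].
  have -> : q - (x + s *: (y - x)) = (1 - s) *: (q - x) + s *: (q - y).
    by apply/rowP => i; rewrite !mxE; ring.
  rewrite (le_lt_trans (ler_normD _ _))// !normrZ !ger0_norm ?subr_ge0//.
  have s1' : 0 <= 1 - s by rewrite subr_ge0.
  move: xq yq; set X := `|q - x|; set Y := `|q - y| => xq yq.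
  have [XY|/ltW YX] := leP X Y.
    by have := ler_wpM2l s1' XY; lra.
  by have := ler_wpM2l s0 YX; lra.
have UO : U `<=` Omega by apply: path_in; rewrite t0t ltnW.
have := cells_chain n0 oU cU UO UA UB; set r := (X in connect X) => AB.
have close C : touches M U C -> `|center M C - q| <= 2 * h.
  move=> /asboolP[z [Cz]]; rewrite /U -ball_normE /= => zq.
  have := closure_cell_near bO (subset_closure Cz); rewrite distrC => zC.
  rewrite -(subrK z (center M C)) -addrA (le_trans (ler_normD _ _))//.
  have d8 : delta <= 1 / 8 * h by rewrite /delta ler_pM2r.
  by rewrite distrC in zq; lra.
have S0 : 0 <= \sum_(i | near (t, k) i) du u i by rewrite sumr_ge0.
have := @connect_le R T r [pred C | `|center M C - q| <= 2 * h] u _ A B S0.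
move=> /(_ _ _ AB) H; apply: (le_trans (H _ _)).
- by move=> C D /and3P[_ _ /close].
- move=> C D /and3P[CD UC UD].
  rewrite (bigD1 (C, D)) /=; last by rewrite /near /= t0t CD !close.
  by rewrite {1}/du /= CD lerDl sumr_ge0.
- rewrite ler_wpM2r// (le_trans _ (card_close q))// ler_nat subset_leq_card//.
  by apply/fintype.subsetP => C; rewrite !inE.
Qed.

(** The value at the vertex is bounded along each path by the value at its end
    plus the jumps near the path; averaging over the directions leaves a
    mean value over a set of fixed size and the sum bounded by [sum_near_le]. *)
Lemma value_le_paths (u : T -> R) :
  `|u K0| <=
  N%:R^-1 * Cdir * (\sum_K `|u K| ^+ d) `^ d%:R^-1 +
  Nnear * (((Nnear ^+ 2 * Cweight `^ n%:R^-1) * (1 + ln N%:R)) `^ (n%:R / d%:R) *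
    (\sum_K \sum_(L | adj M K L) `|u L - u K| ^+ d) `^ d%:R^-1).
Proof.
have Nd0 : 0 < N%:R ^+ d :> R by exact: exprn_gt0.
have cardd : #|dir|%:R = N%:R ^+ d :> R by rewrite card_ffun !card_ord natrX.
have cellat (s : nat * dir) : exists A,
   ((t0 <= s.1 <= N)%N -> closure (cell M A) (p s.1 s.2)) /\ (s.1 = t0 -> A = K0).
  have [->|st] := eqVneq s.1 t0.
    by exists K0; split => // _; apply: subset_closure; exact: path_start.
  have [sN|sN] := boolP (t0 <= s.1 <= N)%N; last first.
    by exists K0; split => // /eqP; rewrite (negbTE st).
  have Os : Omega (p s.1 s.2) by apply: path_in sN _ _; apply: ballxx; exact: mulr_gt0.
  have : closure Omega (p s.1 s.2) by exact: subset_closure.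
  by rewrite (cells_cover M) => -[A _ As]; exists A; split => // /eqP; rewrite (negbTE st).
(* [kap (t, k)] is a cell whose closure contains the point of the path, and [K0]
   at the initial time *)
have [kap kapP] := choice cellat.
have kapc t k : (t0 <= t <= N)%N -> closure (cell M (kap (t, k))) (p t k).
  by have [H _] := kapP (t, k).
have kap0 k : kap (t0, k) = K0 by have [_ ->] := kapP (t0, k).
pose V (t : 'I_N) k := \sum_(i | near (t, k) i) du u i.
have V0 t k : 0 <= V t k by exact: sumr_ge0.
have along k (t : nat) : (t0 <= t <= N)%N ->
    `|u K0| <= `|u (kap (t, k))| + Nnear * \sum_(s < N | (s < t)%N) V s k.
  elim: t => [|t IH] /andP[tt tN].
    move: tt t00; rewrite leqn0 => /eqP ->; by [].
  have [tt0|tt0] := eqVneq t.+1 t0.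
    by rewrite tt0 kap0 lerDl mulr_ge0// sumr_ge0.
  have t0t : (t0 <= t)%N by rewrite -ltnS ltn_neqAle eq_sym tt0.
  rewrite (bigD1 (Ordinal tN)) //=.
  have -> : \sum_(s < N | (s < t.+1)%N && (s != Ordinal tN)) V s k =
            \sum_(s < N | (s < t)%N) V s k.
    apply: eq_bigl => s; rewrite -val_eqE /= ltnS ltn_neqAle andbC.
    by [].
  have J := @jump u (Ordinal tN) k _ _ t0t (kapc t k _) (kapc t.+1 k _).
  have {}J : `|u (kap (t.+1, k)) - u (kap (t, k))| <= Nnear * V (Ordinal tN) k.
    by apply: J; rewrite ?t0t ?tt ?tN//= ltnW.
  have tr : `|u (kap (t, k))| <=
      `|u (kap (t.+1, k))| + `|u (kap (t.+1, k)) - u (kap (t, k))|.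
    rewrite -{1}(subKr (u (kap (t.+1, k))) (u (kap (t, k)))).
    exact: ler_normB.
  have := IH; rewrite t0t ltnW// => /(_ isT) IH'.
  rewrite mulrDr; move: IH' tr J.
  set X := Nnear * \sum_(_ < N | _) _; set Y := Nnear * V _ _; lra.
have {}along k : `|u K0| <= `|u (kap (N, k))| + Nnear * \sum_(s < N) V s k.
  have := along k N; rewrite t0N leqnn => /(_ isT) /le_trans; apply.
  rewrite lerD2l ler_wpM2l// le_eqVlt; apply/orP; left; apply/eqP.
  by apply: eq_bigl => s; rewrite ltn_ord.
have : N%:R ^+ d * `|u K0| <= \sum_k `|u (kap (N, k))| +
    Nnear * \sum_s \sum_(i | near s i) du u i.
  rewrite -cardd mulr_natl -sumr_const.
  rewrite -(pair_bigA _ (fun t k => \sum_(i | near (t, k) i) du u i)) /=.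
  rewrite exchange_big /= mulr_sumr -big_split /=.
  by apply: ler_sum => k _; exact: along.
have part2 : \sum_s \sum_(i | near s i) du u i <=
  N%:R ^+ d * (((Nnear ^+ 2 * Cweight `^ n%:R^-1) * (1 + ln N%:R)) `^ (n%:R / d%:R) *
    (\sum_K \sum_(L | adj M K L) `|u L - u K| ^+ d) `^ d%:R^-1).
  have Nnear20 : 0 <= Nnear ^+ 2 by exact: sqr_ge0.
  have tau0 (s : 'I_N * dir) : (0 : R) <= s.1%:R by [].
  have := sum_near_le n0 Cweight0 Nnear20 Nd0 (du0 u) tau0 card_near weight_le.
  move=> /le_trans; apply; rewrite ler_pM2l//.
  have -> : \sum_i du u i ^+ d = \sum_K \sum_(L | adj M K L) `|u L - u K| ^+ d.
    rewrite (eq_bigr (fun K => \sum_L du u (K, L) ^+ d)); last first.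
      move=> K _; rewrite big_mkcond /=; apply: eq_bigr => L _.
      by rewrite /du /=; case: ifP => // _; rewrite expr0n.
    by rewrite pair_bigA; apply: eq_bigr => -[].
  rewrite ler_wpM2r ?powR_ge0//.
  have -> : (N%:R ^+ d)^-1 * \sum_(s : 'I_N * dir) (s.1%:R : R)^-1 =
      \sum_(t < N) (t%:R : R)^-1.
    rewrite -(pair_bigA _ (fun (t : 'I_N) (k : dir) => (t%:R : R)^-1)) /=.
    rewrite mulr_sumr; apply: eq_bigr => t _.
    by rewrite sumr_const -[X in _ * X]mulr_natl cardd mulKf// gt_eqF.
  have cc0 : 0 <= Nnear ^+ 2 * Cweight `^ n%:R^-1 by rewrite mulr_ge0// powR_ge0.
  apply: ge0_ler_powR; rewrite ?nnegrE ?divr_ge0//.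
  - by rewrite mulr_ge0// sumr_ge0// => t _; rewrite invr_ge0.
  - by rewrite mulr_ge0// addr_ge0// ln_ge0// ler1n.
  - by rewrite ler_wpM2l// harmonic_le.
have part1 : \sum_k `|u (kap (N, k))| <=
    N%:R ^+ d * (N%:R^-1 * Cdir * (\sum_K `|u K| ^+ d) `^ d%:R^-1).
  pose q : R := d%:R / n%:R.
  have nR : (0 : R) < n%:R by rewrite ltr0n.
  have q0 : 0 < q by rewrite divr_gt0.
  have pq : q^-1 + d%:R^-1 = 1.
    by rewrite /q invf_div -[X in _ + X]mul1r -mulrDl natr1 divff// gt_eqF.
  have := @hoelder_fsum R dir (fun=> 1) (fun k => `|u (kap (N, k))|) q d%:R
    (fun=> ler01) (fun=> normr_ge0 _) q0 dR pq.
  rewrite (eq_bigr (fun k => `|u (kap (N, k))|)) => [|k _]; last by rewrite mul1r.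
  move=> /le_trans; apply.
  rewrite (eq_bigr (fun=> 1)) => [|k _]; last by rewrite powR1.
  rewrite sumr_const cardd.
  have -> : (N%:R ^+ d) `^ q^-1 = N%:R ^+ n.
    rewrite -!powR_mulrn// -powRrM; congr (_ `^ _).
    by rewrite /q invf_div mulrC divfK// gt_eqF.
  have -> : N%:R ^+ d * (N%:R^-1 * Cdir * (\sum_K `|u K| ^+ d) `^ d%:R^-1) =
     N%:R ^+ n * (Cdir * (\sum_K `|u K| ^+ d) `^ d%:R^-1).
    by rewrite exprS; field; rewrite gt_eqF.
  rewrite ler_pM2l ?exprn_gt0//.
  have -> : Cdir = (Cdir ^+ d) `^ d%:R^-1.
    by rewrite -powR_mulrn ?(ltW Cdir0)// -powRrM divff ?gt_eqF// powRr1// ltW.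
  have Cdird : 0 <= Cdir ^+ d by rewrite exprn_ge0// ltW.
  have sd0 : 0 <= \sum_K `|u K| ^+ d by rewrite sumr_ge0// => K _; exact: exprn_ge0.
  rewrite -powRM//.
  apply: ge0_ler_powR; rewrite ?nnegrE ?invr_ge0 ?mulr_ge0//.
    by rewrite sumr_ge0// => k _; exact: powR_ge0.
  rewrite (eq_bigr (fun k => `|u (kap (N, k))| ^+ d)) => [|k _]; last by rewrite powR_mulrn.
  rewrite (partition_big (fun k => kap (N, k)) xpredT)//= mulr_sumr.
  apply: ler_sum => K _.
  rewrite (eq_bigr (fun=> `|u K| ^+ d)) => [|k /eqP -> //].
  rewrite sumr_const -[leLHS]mulr_natl ler_wpM2r ?exprn_ge0//.
  apply: (@le_trans _ _ (#|[set k | `|p N k - center M K| <= 2 * h]%SET|%:R)).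
    rewrite ler_nat subset_leq_card//; apply/fintype.subsetP => k.
    move=> /eqP kK; rewrite inE -kK.
    have : closure (cell M (kap (N, k))) (p N k) by apply: kapc; rewrite t0N leqnn.
    move=> /(closure_cell_near bO) /le_trans; apply.
    by rewrite ler_peMl ?ler1n// ltW.
  have NN : (0 < N <= N)%N by rewrite N_gt0 leqnn.
  by have := path_count (center M K) NN; rewrite divff ?gt_eqF// mulr1.
move=> H; rewrite -(ler_pM2l Nd0) mulrDr.
apply: (le_trans H); apply: lerD => //.
by rewrite mulrCA ler_wpM2l.
Qed.

End paths.

(** * The discrete Sobolev inequality *)

Section pointwise_bound.
Context {R : realType} {n : nat}.
Local Notation d := n.+1.

Lemma norm_le_sum_root (T : finType) (u : T -> R) K :
  `|u K| <= (\sum_K `|u K| ^+ d) `^ d%:R^-1.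
Proof.
have -> : `|u K| = (`|u K| ^+ d) `^ d%:R^-1.
  by rewrite -powR_mulrn// -powRrM divff ?pnatr_eq0// powRr1.
apply: ge0_ler_powR; rewrite ?nnegrE ?invr_ge0 ?exprn_ge0//.
  by rewrite sumr_ge0// => L _; exact: exprn_ge0.
by rewrite (bigD1 K)//= lerDl sumr_ge0// => L _; exact: exprn_ge0.
Qed.

(** When [h] is small with respect to [rho], the paths are stopped near half of
    the height of the cone and [ln N] is comparable with [`|ln (mu h)|].
    Otherwise [h] is bounded from below, and the first sum, which contains
    [`|u K0| ^+ d], suffices. *)
Lemma value_le (Omega : set 'rV[R]_d) (rho theta mu lambda : R) :
  (0 < n)%N -> bounded_set Omega -> 0 < rho -> 0 < theta <= d%:R^-1 ->
  0 < mu <= 1 / 2 ->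
  (forall x, Omega x -> exists e : 'rV[R]_d, d%:R^-1 <= `|e| <= 1 /\
    forall (s : R) w, 0 < s < rho -> `|w| < theta -> Omega (x + s *: (e + w))) ->
  exists2 C : R, 0 < C & forall (T E : finType) (M : mesh Omega T E),
    regular_mesh M mu lambda -> mu * mesh_size M < expR (-1) ->
    forall (u : T -> R) K0,
    `|u K0| <= C * (mesh_size M * (\sum_K `|u K| ^+ d) `^ d%:R^-1 +
      `|ln (mu * mesh_size M)| `^ (n%:R / d%:R) *
      (\sum_K \sum_(L | adj M K L) `|u L - u K| ^+ d) `^ d%:R^-1).
Proof.
move=> n0 bO rho0 /andP[theta0 thetad] /andP[mu0 mu1] cone.
have dR : (0 : R) < d%:R by rewrite ltr0n.
pose t0 := (Num.truncn (6 / theta)).+1.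
have t00 : (0 < t0)%N by [].
have t0theta : 6 / theta <= t0%:R.
  have q0 : 0 <= 6 / theta by rewrite divr_ge0// ltW.
  by have /andP[_ /ltW] := truncn_itv q0.
pose step : R := mu / d%:R / (4 * t0%:R).
have step0 : 0 < step by rewrite !divr_gt0// mulr_gt0.
pose Cdir : R := 8 / (step * theta) + 1.
have Cdir0 : 0 < Cdir by rewrite addr_gt0// divr_gt0// mulr_gt0.
pose Ctime : R := 4 * d%:R + 8 * d%:R / step.
pose Cweight : R := 3 * Ctime * (Cdir * Ctime) ^+ d.
pose Nnear : R := (4 * d%:R / mu + 1) ^+ d.
have Nnear0 : 0 <= Nnear by rewrite exprn_ge0// addr_ge0// divr_ge0 ?(ltW mu0)// mulr_ge0.
pose A : R := 2 + `|ln (rho * mu / (2 * step))|.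
have A0 : 0 < A by rewrite ltr_pwDl.
pose B1 : R := 4 * step / rho * Cdir.
pose B2 : R := Nnear * (Nnear ^+ 2 * Cweight `^ n%:R^-1 * A) `^ (n%:R / d%:R).
pose B3 : R := 2 * step * t0%:R / rho.
have B10 : 0 < B1 by rewrite mulr_gt0// divr_gt0// mulr_gt0.
have B20 : 0 <= B2 by rewrite mulr_ge0// powR_ge0.
have B30 : 0 < B3 by rewrite divr_gt0// mulr_gt0// mulr_gt0.
exists (B1 + B2 + B3); first by rewrite addr_gt0// ltr_wpDr.
move=> T E M reg muh u K0; set h := mesh_size M.
have h0 : 0 < h  by exact: (mesh_size_gt0 M bO K0).
set S1 := (\sum_K `|u K| ^+ d) `^ _.
set S2 := (\sum_K \sum_(L | _) _) `^ _.
set L := `|ln (mu * h)|.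
have S10 : 0 <= S1 by exact: powR_ge0.
have S20 : 0 <= S2 by exact: powR_ge0.
have mh0 : 0 < mu * h by exact: mulr_gt0.
have lnmh : ln (mu * h) < -1 by rewrite -[X in _ < X]expRK ltr_ln ?posrE ?expR_gt0.
have L1 : 1 <= L by rewrite /L ltr0_norm; lra.
have Lp0 : 0 <= L `^ (n%:R / d%:R) by exact: powR_ge0.
pose delta := step * h.
have delta0 : 0 < delta by exact: mulr_gt0.
have split_bound (a b : R) : 0 <= a <= B1 + B2 + B3 -> 0 <= b <= B1 + B2 + B3 ->
    a * (h * S1) + b * (L `^ (n%:R / d%:R) * S2) <=
    (B1 + B2 + B3) * (h * S1 + L `^ (n%:R / d%:R) * S2).
  move=> /andP[_ ha] /andP[_ hb]; rewrite mulrDr lerD// ler_wpM2r//.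
    by rewrite mulr_ge0// ltW.
  by rewrite mulr_ge0.
have [big|small] := leP (2 * delta * t0%:R) rho; last first.
  apply: le_trans (split_bound B3 0 _ _); last 2 first.
  - by apply/andP; split; lra.
  - by apply/andP; split; lra.
  rewrite mul0r addr0 (le_trans (norm_le_sum_root u K0))// -/S1 mulrA ler_peMl//.
  by rewrite /B3 mulrAC ler_pdivlMr// mul1r; move: small; rewrite /delta; lra.
have d20 : 0 < 2 * delta by exact: mulr_gt0.
pose x := rho / (2 * delta).
have x0 : 0 < x by exact: divr_gt0.
pose N := Num.truncn x.
have /andP[Nx xN] : N%:R <= x < N.+1%:R by apply: truncn_itv; exact: ltW.
have t0x : t0%:R <= x by rewrite /x ler_pdivlMr// [leLHS]mulrC.
have t0N : (t0 <= N)%N by rewrite -ltnS -(ltr_nat R) (le_lt_trans t0x).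
have N_gt0 : (0 < N)%N by exact: leq_trans t0N.
have NR : (0 : R) < N%:R by rewrite ltr0n.
have Nrho : N%:R * delta < rho.
  apply: (@le_lt_trans _ _ (x * delta)); first by rewrite ler_pM2r.
  rewrite (_ : x * delta = rho / 2); first by lra.
  by rewrite /x; field; rewrite gt_eqF.
have [e [eb econe]] := cone _ (cell_sub (center_in M K0)).
have := value_le_paths n0 bO reg mu0 mu1 theta0 thetad eb econe t00 t0theta t0N Nrho u.
rewrite -/step -/Cdir -/Ctime -/Cweight -/Nnear -/S1 -/S2 => /le_trans; apply.
apply: le_trans (split_bound B1 B2 _ _); last 2 first.
- by apply/andP; split; lra.
- by apply/andP; split; lra.
apply: lerD.
  rewrite mulrA ler_wpM2r// /B1 mulrAC ler_pM2r//.
  have : x < 2 * N%:R.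
    apply: (lt_le_trans xN); rewrite -natr1 mulrDl mul1r lerD2l ler1n//.
  rewrite /x ltr_pdivrMr// => xx.
  rewrite -[leLHS]mul1r ler_pdivrMr// mulrAC mulrAC -mulrA mulrAC ler_pdivlMr// mul1r.
  by move: xx; rewrite /delta => /ltW; lra.
rewrite /B2 -[leRHS]mulrA ler_wpM2l// mulrA ler_wpM2r//.
rewrite -powRM; last 2 first.
- by rewrite !mulr_ge0 ?powR_ge0// ltW.
- exact: le_trans L1.
have Nnear20 : 0 <= Nnear ^+ 2 * Cweight `^ n%:R^-1 by rewrite mulr_ge0 ?powR_ge0// sqr_ge0.
have lnN0 : 0 <= ln N%:R :> R by rewrite ln_ge0// ler1n.
apply: ge0_ler_powR; rewrite ?nnegrE ?divr_ge0//.
- by rewrite mulr_ge0// addr_ge0.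
- exact: mulr_ge0 (mulr_ge0 Nnear20 (ltW A0)) (normr_ge0 _).
rewrite -[leRHS]mulrA ler_wpM2l//.
have lnN : ln N%:R <= `|ln (rho * mu / (2 * step))| + L.
  apply: (@le_trans _ _ (ln x)); first by rewrite ler_ln ?posrE.
  have -> : x = (rho * mu / (2 * step)) / (mu * h).
    by rewrite /x /delta; field; rewrite !gt_eqF.
  have q0 : 0 < rho * mu / (2 * step).
    by apply: divr_gt0; exact: mulr_gt0.
  rewrite ln_div ?posrE//.
  by apply: lerD; [exact: ler_norm|rewrite /L -normrN; exact: ler_norm].
have := ler_wpM2l (normr_ge0 (ln (rho * mu / (2 * step)))) L1.
rewrite mulr1 /A; move: lnN; set a := `|ln (rho * mu / _)|.
by move=> h1 h2; rewrite mulrDl; lra.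
Qed.

End pointwise_bound.

Lemma discrete_sobolev_succ (R : realType) (n : nat) : (0 < n)%N ->
  exists2 Cd : R, 0 < Cd &
  forall Omega : set 'rV[R]_n.+1,
    bounded_set Omega -> open Omega -> lipschitz_boundary Omega ->
  forall mu lambda : R, 0 < mu <= 1 / 2 -> 0 < lambda <= 1 / 2 ->
  exists2 C : R, 0 < C &
  forall (T E : finType) (M : mesh Omega T E),
    regular_mesh M mu lambda -> mesh_size M < Cd * mu^-1 ->
  forall u : T -> R,
    (norm0 M +oo u <=
     (C * `|ln (mu * mesh_size M)| `^ (1 - n.+1%:R^-1))%:E * norm1d M u)%E.
Proof.
move=> n0; exists (expR (-1)); first exact: expR_gt0.
move=> Omega bO oO lip mu lambda mub /andP[lambda0 _].
have dR : (0 : R) < n.+1%:R by rewrite ltr0n.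
have /andP[mu0 mu1] := mub.
have [rho [theta [rho0 theta0 cone]]] := cone_condition bO oO lip.
pose theta' := Num.min theta n.+1%:R^-1.
have theta'b : 0 < theta' <= n.+1%:R^-1.
  by rewrite lt_min theta0 invr_gt0 dR ge_min lexx orbT.
have [|C C0 CP] := @value_le R n Omega rho theta' mu lambda n0 bO rho0 theta'b mub.
  move=> x Ox; have [e [eb ec]] := cone x Ox; exists e; split => // s w sr wt.
  by apply: ec => //; rewrite (lt_le_trans wt)// ge_min lexx.
pose wd : R := unit_ball_volume R n.+1.
have wd0 : 0 < wd by exact: unit_ball_volume_gt0.
pose b1 : R := wd `^ n.+1%:R^-1 * (mu / n.+1%:R / 24).
pose kap : R := @seminorm_const R n lambda.
have kap0 : 0 < kap by exact: seminorm_const_gt0.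
pose b2 := kap `^ n.+1%:R^-1.
have b10 : 0 < b1 by rewrite mulr_gt0 ?powR_gt0// !divr_gt0.
have b20 : 0 < b2 by exact: powR_gt0.
pose b := Num.min b1 b2.
have b0 : 0 < b by rewrite lt_min b10.
exists (C / b); first exact: divr_gt0.
move=> T E M reg hlt u; set h := mesh_size M.
have muh : mu * h < expR (-1).
  by rewrite mulrC -ltr_pdivlMr.
set S1 := (\sum_K `|u K| ^+ n.+1) `^ n.+1%:R^-1.
set S2 := (\sum_K \sum_(L | adj M K L) `|u L - u K| ^+ n.+1) `^ n.+1%:R^-1.
have S10 : 0 <= S1 by exact: powR_ge0.
have S20 : 0 <= S2 by exact: powR_ge0.
have -> : 1 - n.+1%:R^-1 = n%:R / n.+1%:R :> R.
  by rewrite -[n%:R](addrK 1) natr1 mulrBl mul1r divff// gt_eqF.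
set P := _ `^ (n%:R / n.+1%:R).
have P0 : 0 <= P by exact: powR_ge0.
have h0 : 0 <= h by exact: bigmax_ge_id.
have CbP : 0 <= C / b * P by rewrite mulr_ge0// divr_ge0// ltW.
(* without cells there is no center to start from, and the left-hand side is 0 *)
have [K0|Tempty] := pickP (fun _ : T => true); last first.
  apply: le_trans (@norm0_oo_le _ _ _ _ _ M _ u 0 (lexx _) _) _.
  - by move=> K L x Kx; have := Tempty K.
  - by move=> K; have := Tempty K.
  apply: mule_ge0; first by rewrite lee_fin.
  by apply: adde_ge0; [exact: Lnorm_ge0|rewrite lee_fin powR_ge0].
move=> _; have hp : 0 < h  by exact: (mesh_size_gt0 M bO K0).
have lnmh : ln (mu * h) < -1.
  by rewrite -[X in _ < X]expRK ltr_ln ?posrE ?expR_gt0// mulr_gt0.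
have P1 : 1 <= P.
  have <- : 1 `^ (n%:R / n.+1%:R) = 1 :> R by rewrite powR1.
  by apply: ge0_ler_powR; rewrite ?nnegrE ?divr_ge0// ltr0_norm; lra.
have low1 : ((b1 * (h * S1))%:E <= norm0 M n.+1%:R%:E u)%E.
  have step : 0 <= wd * (mu * h / n.+1%:R / 24) ^+ n.+1.
    by rewrite mulr_ge0 ?(ltW wd0)// exprn_ge0// !divr_ge0// mulr_ge0// ltW.
  have := norm0_d_ge (ltn0Sn n) (@cell_disj _ _ _ _ _ M n0) u step (cell_volume_ge bO reg mu0).
  apply: le_trans; rewrite lee_fin le_eqVlt; apply/orP; left; apply/eqP.
  have q0 : 0 <= mu * h / n.+1%:R / 24 by rewrite !divr_ge0// mulr_ge0// ltW.
  rewrite powRM//; last by rewrite sumr_ge0// => K _; exact: exprn_ge0.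
  rewrite -/S1 powRM ?exprn_ge0 ?(ltW wd0)// -powR_mulrn// -powRrM.
  rewrite divff ?gt_eqF// powRr1// /b1; ring.
have low2 : b2 * S2 <= seminorm1d M u.
  have := seminorm1d_ge n0 bO reg mu0 lambda0 u.
  apply: le_trans; rewrite powRM ?(ltW kap0)//.
  by rewrite sumr_ge0// => K _; rewrite sumr_ge0// => L _; exact: exprn_ge0.
have low : ((b * (h * S1 + S2))%:E <= norm1d M u)%E.
  rewrite /norm1d mulrDr EFinD; apply: leeD.
    apply: le_trans low1; rewrite lee_fin ler_wpM2r ?mulr_ge0//.
    by rewrite ge_min lexx.
  by rewrite lee_fin (le_trans _ low2)// ler_wpM2r// ge_min lexx orbT.
have CbP' : (0%E <= (C / b * P)%:E)%E by rewrite lee_fin.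
apply: le_trans (lee_wpmul2l CbP' low).
rewrite -EFinM; apply: norm0_oo_le.
- exact: cell_disj.
- by rewrite mulr_ge0// mulr_ge0 ?(ltW b0)// addr_ge0// mulr_ge0.
move=> K; apply: (le_trans (CP _ _ M reg muh u K)); rewrite -/S1 -/S2 -/h -/P.
have -> : C / b * P * (b * (h * S1 + S2)) = C * (P * (h * S1) + P * S2).
  by field; rewrite gt_eqF.
rewrite ler_pM2l// lerD2r ler_peMl// mulr_ge0//.
Qed.

Theorem proposition8 (R : realType) (d : nat) (hd : (2 <= d)%N) :
  exists2 Cd : R, 0 < Cd &
  forall Omega : set 'rV[R]_d,
    bounded_set Omega -> connected Omega -> open Omega -> polyhedral Omega ->
    lipschitz_boundary Omega ->
  forall mu lambda : R, 0 < mu <= 1 / 2 -> 0 < lambda <= 1 / 2 ->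
  exists2 C : R, 0 < C &
  forall (T E : finType) (M : mesh Omega T E),
    regular_mesh M mu lambda -> mesh_size M < Cd * mu^-1 ->
  forall u : T -> R,
    (norm0 M +oo u <=
     (C * `|ln (mu * mesh_size M)| `^ (1 - d%:R^-1))%:E * norm1d M u)%E.
Proof.
case: d hd => [//|n] n0.
have [Cd Cd0 CdP] := @discrete_sobolev_succ R n n0.
by exists Cd => // Omega bO _ oO _ lip; exact: CdP.
Qed.
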